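(* Consider the binary optimal treatment value $\Psi(P)=E_{P_X}[\max_{a\in\{0,1\}}u_{P,a}(X)]$ with $u_{P,a}(x)=E_P[Y\mid X=x,A=a]$ (so the arm link is $g(x,a,u_a)=u_a$, $g'\equiv1$), and assume the equality conditions listed in the context hold at $P$. Then the conditional variance floor $V^{\min}(x;P)=\big(\sum_{a\in S(x)}\pi_a^P(x)/\sigma_a^2(x;P)\big)^{-1}$, where $S(x)=\arg\max_a u_{P,a}(x)$, reduces as follows. For $P_X$-a.e. $x$ in the strict region $u_{P,0}(x)\ne u_{P,1}(x)$, with unique optimal arm $a^*=a^*(x)$, $$V^{\min}(x;P)=\frac{\sigma_{a^*}^2(x;P)}{\pi_{a^*}^P(x)},$$ and for $P_X$-a.e. $x$ in the kink region $u_{P,0}(x)=u_{P,1}(x)$, $$V^{\min}(x;P)=\Big(\frac{\pi_1^P(x)}{\sigma_1^2(x;P)}+\frac{\pi_0^P(x)}{\sigma_0^2(x;P)}\Big)^{-1}.$$ This recovers, as a special case, the efficiency bound of Xu and Guo for the binary optimal treatment value (described in the context): Theorem 3 of Xu and Guo under conditional homoscedasticity $\sigma_0^2(x;P)=\sigma_1^2(x;P)=\sigma^2(x)$, where the kink term reduces to $\sigma^2(x)$, and Theorem A.1 of the supplement of Xu and Guo in general.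
   Context: Observation $(X,A,Y)$, $\mathcal A=\{0,1\}$, $W=(A,Y)\in\mathcal W=\mathcal A\times\mathbb R$; $\mathcal P$ is a class of laws on $\mathcal X\times\mathcal W$ ($\mathcal X$ Polish), $P_X$ the marginal of $X$, $Q_x^P$ the law of $W$ given $X=x$, $\pi_a^P(x)=P(A=a\mid X=x)>0$, $Q_{x,a}^P$ the law of $Y$ given $(X,A)=(x,a)$, $\sigma_a^2(x;P)=\mathrm{Var}_{Q^P_{x,a}}(Y)$, and $\max_a u_{P,a}\in L^1(P_X)$ for $P\in\mathcal P$. Robust class. Nuisances $\eta_1(P)=(u_{P,a})_a$, $\eta_2(P)=\pi^P$ (valued in the open simplex); structural component $\kappa(P)(x)=S(x)=\arg\max_au_{P,a}(x)$; Polish auxiliary space $\mathcal W_{\mathrm{aux}}$; $\mathcal N_0,\mathcal K_0$ the value spaces of $\eta,\kappa$. $\mathcal F_{\mathrm B}$: all measurable $f:\mathcal X\times\mathcal W\times\mathcal N_0\times\mathcal K_0\times\mathcal W_{\mathrm{aux}}\to\mathbb R$ such that for all $P,P'\in\mathcal P$ and measurable $w:\mathcal X\to\mathcal W_{\mathrm{aux}}$, if $\eta_1(P')=\eta_1(P)$ or $\eta_2(P')=\eta_2(P)$ $P_X$-a.s., then $f(X,W,\eta(P')(X),\kappa(P)(X),w(X))\in L^1(P)$ with $P$-mean $\Psi(P)$. Write $f_w^P(x,W)=f(x,W,\eta(P)(x),\kappa(P)(x),w(x))$. $V^{\min}(\cdot;P)$ is the essential infimum in $L^0(P_X)$ of $\mathrm{Var}_{Q_x^P}[f_w^P(x,\cdot)]$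 over $f\in\mathcal F_{\mathrm B}$ with $\mathrm{Var}_P[f_w^P]<\infty$ ($+\infty$ if there is none; it does not depend on $w$). The associated total variance floor is $V_{\mathrm{low}}(P)=\mathrm{Var}_{P_X}[\max_au_{P,a}(X)]+E_{P_X}[V^{\min}(X;P)]$. The Xu–Guo bound. Xu and Guo (an earlier paper on the binary optimal treatment value) derived a sharp asymptotic-variance lower bound for robust asymptotically linear unbiased estimators. In general form (Theorem A.1 of their supplement, allowing unequal conditional outcome variances) it is $\mathrm{Var}_{P_X}[\max(u_{P,0},u_{P,1})(X)]+E_{P_X}\big[\big(\sum_{a\in S(X)}\pi_a^P(X)/\sigma_a^2(X;P)\big)^{-1}\big]$; their Theorem 3 is the conditionally homoscedastic version. ''Recovering'' means that the floor above coincides with this bound. Equality conditions. (1) Standing model conditions: a Borel graph $\{(x,Q):Q\in\mathfrak K_x\}$ of admissible conditional laws with Borel local readouts of $\eta,\kappa$ and of the target integrand; (a) $\mathcal P$ is closed under restricting and renormalizing $P_X$ to sets of positive probability with unchanged kernel, with unchanged nuisance and structural values there; (b) a finite Borel cost $C(x,Q)\ge1$ dominates the absolute target integrand and controls the moments required by the model, $Q_x^P\in\mathfrak K_x$ a.s. and $\int C(x,Q_x^P)\,dP_X<\infty$ for $P\in\mathcal P$, and every universally measurable selection $R_x\in\mathfrak K_x$ with integrable cost defines, with marginal $P_X$, a law in $\mathcal P$; (c) $\eta(P)(x),\kappa(P)(x)$ and the integrand are given $P_X$-a.e. by the local readouts at $Q_x^P$. Selections of nonintegrable cost are used only on $\{C\le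 m\}$, with the baseline kernel elsewhere. (2) Max-arm perturbation conditions, for every $P\in\mathcal P$ and $P_X$-a.e. $x$: (X1) for each $a$, with $\pi^P(x)$ and the other arm law fixed, all $(1-\epsilon)Q_{x,a}^P+\epsilon\nu$ with $\epsilon\in(0,1)$ and $\nu$ a finitely supported probability on $\mathrm{supp}\,Q_{x,a}^P$ with mean $u_{P,a}(x)$ are admissible (Borel graph, finite cost; integrable-cost selections glue to laws in $\mathcal P$ with the same $P_X,\eta,\kappa$); (X2) there are a Borel-graph correspondence $D_x\subseteq\mathbb R^2$ with $0\in D_x$ and a measurable $\mathcal R_P(x)\subseteq\mathcal A\setminus S(x)$ such that $te_a\in D_x$ for $a\in\mathcal R_P(x)$ and all sufficiently small $t$ leaving $a$ inactive, and $D_x$ contains the path $t\sum_{a\in S(x)}e_a$ for $|t|<\epsilon_P(x)$, with $\epsilon_P>0$ measurable; (X3) for each $\delta\in D_x$ there is $Q_{x,\delta}\ll Q_x^P$ with arm probabilities $\pi^P(x)$ and arm means $u_P(x)+\delta$, $Q_{x,0}=Q_x^P$, changing only $\eta_1$ and preserving $\eta_2$ and $\kappa$ (Borel graph, finite cost; integrable-cost universally measurable selections glue to laws in $\mathcal P$ with marginal $P_X$). (3) For $P_X$-a.e. $x$: $\sigma_a^2(x;P)<\infty$ for all $a$ and $\sigma_a^2(x;P)>0$ for $a\in S(x)$. (4) Oracle realization at $P$: with $\lambda_a^*(x)=\frac{\pi_a^P/\sigma_a^2}{\sum_{b\in S}\pi_b^P/\sigma_b^2}(x)$ on $S(x)$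 and zero elsewhere, the function $\max_bu_{P,b}(x)+\mathbf 1\{a\in S(x)\}\frac{\lambda_a^*(x)}{\pi_a^P(x)}\{y-u_{P,a}(x)\}$ equals $f_w^P$ $P$-a.s. for some $f\in\mathcal F_{\mathrm B}$ and measurable $w$, and has finite variance under $P$. *)

(* Defs.v *)
From HB Require Import structures.
From mathcomp Require Import all_boot all_order all_algebra.
From mathcomp Require Import all_classical all_reals all_analysis measurable_realfun.
Set Implicit Arguments.
Unset Strict Implicit.
Unset Printing Implicit Defensive.
Import Order.TTheory GRing.Theory Num.Theory.
Import numFieldNormedType.Exports.
Local Open Scope classical_set_scope.
Local Open Scope ring_scope.

(* Arms are booleans, [false] for arm 0 and [true] for
   arm 1; a vector indexed by the arms is a pair (arm 0, arm 1); a set of arms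
   is the pair of its membership bits. *)

Section general.
Context (R : realType).

Definition polish (T : topologicalType) : Prop :=
  (exists2 D : set T, countable D & dense D) /\
  exists dist : T -> T -> R,
    [/\ forall x y, (dist x y == 0) = (x == y),
        forall x y, dist x y = dist y x,
        forall x y z, dist x z <= dist x y + dist y z,
        forall U : set T, open U <->
          (forall x, U x -> exists2 e, 0 < e & [set y | dist x y < e] `<=` U) &
        forall s : nat -> T,
          (forall e, 0 < e -> exists N, forall m n,
             (N <= m)%N -> (N <= n)%N -> dist (s m) (s n) < e) ->
          exists l : T, s @ \oo --> l].

Definition Borel (T : ptopologicalType) : measurableType _ :=
  g_sigma_algebraType (@open T).

(* A measure of the library is a function of all subsets, so Leibniz equality
   of probabilities also compares their values at nonmeasurable sets. *)
Definition same_law d (T : measurableType d) (mu nu : probability T R) :=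
  forall B, measurable B -> mu B = nu B.

(* topological support of a law on the line *)
Definition supp (mu : probability R R) : set R :=
  [set y | forall U : set R, open U -> U y -> (0 < mu U)%E].

Definition univ_measurable d (T : measurableType d) (A : set T) :=
  forall mu : {finite_measure set T -> \bar R},
    exists B C, [/\ measurable B, measurable C, B `<=` A, A `<=` C &
                    mu (C `\` B) = 0%E].

Definition univ_measurable_fun d d' (T : measurableType d)
    (U : measurableType d') (f : T -> U) :=
  forall B, measurable B -> univ_measurable (f @^-1` B).

(* V represents the essential infimum of F in L^0(mu; [-oo, +oo]).  The
   essential infimum of the empty family is +oo. *)
Definition is_essinf d (T : measurableType d) (mu : probability T R)
    (F : set (T -> \bar R)) (V : T -> \bar R) :=
  [/\ measurable_fun setT V,
      forall g, F g -> {ae mu, forall x, (V x <= g x)%E} &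
      forall V', measurable_fun setT V' ->
        (forall g, F g -> {ae mu, forall x, (V' x <= g x)%E}) ->
        {ae mu, forall x, (V' x <= V x)%E}].

Definition essinf d (T : measurableType d) (mu : probability T R)
    (F : set (T -> \bar R)) : T -> \bar R :=
  xget (cst +oo%E) [set V | is_essinf mu F V].

End general.

Section arms.
Context (R : realType).

Definition arm_coord (T : Type) (v : T * T) (a : bool) : T :=
  if a then v.2 else v.1.

Definition argmax (v : R * R) : bool * bool :=
  ([forall b, arm_coord v b <= arm_coord v false],
   [forall b, arm_coord v b <= arm_coord v true]).

Definition maxarm (v : R * R) : R := Num.max v.1 v.2.

Definition simplex (p : R * R) : Prop := [/\ 0 < p.1, 0 < p.2 & p.1 + p.2 = 1].

Definition arm_dir (a : bool) (t : R) : R * R := if a then (0, t) else (t, 0).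

Definition set_dir (s : bool * bool) (t : R) : R * R :=
  (if s.1 then t else 0, if s.2 then t else 0).

(* the value space of w = (a, y) *)
Definition obs : measurableType _ := (bool * R)%type.

Definition outcome (w : obs) : R := w.2.

Lemma measurable_outcome : measurable_fun setT outcome.
Proof. exact: measurable_snd. Qed.

HB.instance Definition _ :=
  isMeasurableFun.Build _ _ _ _ outcome measurable_outcome.

Definition arm_set (a : bool) : set obs := [set a] `*` setT.

Lemma measurable_arm_set a : measurable (arm_set a).
Proof. exact: measurableX. Qed.

(* conditional law of y given a under Q; a Dirac mass if a has probability 0 *)
Definition arm_law (Q : probability obs R) (a : bool) : probability R R :=
  distribution (mnormalize (mrestr Q (measurable_arm_set a)) point) outcome.

Definition arm_integrable (Q : probability obs R) (a : bool) : Prop :=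
  (arm_law Q a).-integrable setT (fun y : R => y%:E).

Definition arm_mean (Q : probability obs R) (a : bool) : R :=
  fine 'E_(arm_law Q a)[fun y => y].

(* +oo if y is not square integrable in arm a *)
Definition arm_var (Q : probability obs R) (a : bool) : \bar R :=
  'V_(arm_law Q a)[fun y => y].

End arms.

Section model.
Context (R : realType) (dX : measure_display) (X : measurableType dX).
Context (dV : measure_display) (V : measurableType dV).
Local Notation W := (obs R).
Local Notation law := (probability (X * W)%type R).

Definition covariate (z : X * W) : X := z.1.

Lemma measurable_covariate : measurable_fun setT covariate.
Proof. exact: measurable_fst. Qed.

HB.instance Definition _ :=
  isMeasurableFun.Build _ _ _ _ covariate measurable_covariate.

Definition marginal (P : law) : probability X R := distribution P covariate.

(* A class of laws, with for each of its members P fixed versions of the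
   kernel x |-> Q_x^P and of the nuisances eta_1(P) = u_P and eta_2(P) = pi^P:
   the robust class evaluates nuisances of one law along another law, so the
   versions matter. *)
Record model := Model {
  laws : set law;
  kern : law -> X -> pprobability W R;
  umean : law -> X -> R * R;
  pscore : law -> X -> R * R }.

Implicit Types (M : model) (P : law).

Definition well_formed M : Prop := forall P, laws M P ->
  [/\ [/\ measurable_fun setT (kern M P) &
          forall A B, measurable A -> measurable B ->
            P (A `*` B) =
            (\int[marginal P]_(x in A) (kern M P x : probability W R) B)%E],
      [/\ measurable_fun setT (umean M P) &
          {ae marginal P, forall x a, arm_integrable (kern M P x) a /\
             arm_coord (umean M P x) a = arm_mean (kern M P x) a}],
      [/\ measurable_fun setT (pscore M P), forall x, simplex (pscore M P x) &
          {ae marginal P, forall x a,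
             (kern M P x : probability W R) (arm_set a) =
             (arm_coord (pscore M P x) a)%:E}] &
      (marginal P).-integrable setT (fun x => (maxarm (umean M P x))%:E)].

Definition kappa M P (x : X) : bool * bool := argmax (umean M P x).

Definition maxu M P (x : X) : R := maxarm (umean M P x).

Definition Psi M P : \bar R := 'E_(marginal P)[maxu M P].

Definition score := (X * W * ((R * R) * (R * R)) * (bool * bool) * V)%type -> R.

(* the product of X, W, the value spaces of eta and kappa, and W_aux; a score
   is only relevant there *)
Definition score_dom : set (X * W * ((R * R) * (R * R)) * (bool * bool) * V) :=
  [set z | simplex z.1.1.2.2 /\ z.1.2 <> (false, false)].

(* eta at P', kappa at P *)
Definition plug M (f : score) (w : X -> V) P' P : X * W -> R := fun z =>
  f (z, (umean M P' z.1, pscore M P' z.1), kappa M P z.1, w z.1).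

Definition robust_class M : set score := [set f |
  measurable_fun score_dom f /\
  forall P P' (w : X -> V), laws M P -> laws M P' -> measurable_fun setT w ->
    {ae marginal P, forall x, umean M P' x = umean M P x} \/
    {ae marginal P, forall x, pscore M P' x = pscore M P x} ->
    P.-integrable setT (fun z => (plug M f w P' P z)%:E) /\
    ('E_P[plug M f w P' P] = Psi M P)%E].

Definition cond_var M P (h : X * W -> R) (x : X) : \bar R :=
  'V_(kern M P x : probability W R)[fun v => h (x, v)].

(* The variance of the library is +oo when the second moment is infinite, and
   the infimum does not depend on w: f may ignore its last argument. *)
Definition Vmin M P (w : X -> V) : X -> \bar R :=
  essinf (marginal P)
    [set g | exists f, [/\ robust_class M f, ('V_P[plug M f w P P] < +oo)%E &
                           g = cond_var M P (plug M f w P P)]].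

Definition Vlow M P (w : X -> V) : \bar R :=
  ('V_(marginal P)[maxu M P] + \int[marginal P]_x Vmin M P w x)%E.

(* [adm] is the correspondence x |-> K_x of admissible conditional laws; the
   other fields are the cost and the local readouts of eta_1, eta_2, kappa and
   of the target integrand. *)
Record local_model := LocalModel {
  adm : X -> set (pprobability W R);
  cost : X -> pprobability W R -> R;
  rd_u : X -> pprobability W R -> R * R;
  rd_pi : X -> pprobability W R -> R * R;
  rd_kappa : X -> pprobability W R -> bool * bool;
  rd_psi : X -> pprobability W R -> R }.

Implicit Types L : local_model.

Definition adm_graph L : set (X * pprobability W R) :=
  [set z | adm L z.1 z.2].

Definition borel_on_graph L d (T : measurableType d)
    (r : X -> pprobability W R -> T) :=
  measurable_fun (adm_graph L) (fun z => r z.1 z.2).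

Definition borel_local_model L : Prop :=
  [/\ measurable (adm_graph L),
      [/\ borel_on_graph L (cost L), borel_on_graph L (rd_u L),
          borel_on_graph L (rd_pi L), borel_on_graph L (rd_kappa L) &
          borel_on_graph L (rd_psi L)] &
      forall x Q, adm L x Q ->
        simplex (rd_pi L x Q) /\ rd_kappa L x Q <> (false, false)].

(* P' is P conditioned on the covariate being in B *)
Definition closed_under_restriction M : Prop :=
  forall P (B : set X), laws M P -> measurable B -> (0 < marginal P B)%E ->
  exists P', [/\ laws M P',
    forall E, measurable E ->
      P' E = (P (E `&` (B `*` setT)) * (fine (marginal P B))^-1%:E)%E,
    {ae marginal P', forall x, same_law (kern M P' x) (kern M P x)} &
    {ae marginal P', forall x, [/\ umean M P' x = umean M P x,
       pscore M P' x = pscore M P x & kappa M P' x = kappa M P x]}].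

(* Rs is a universally measurable selection, P_X-a.e., of the correspondence E,
   with integrable cost *)
Definition selection L P (E : X -> set (pprobability W R))
    (Rs : X -> pprobability W R) : Prop :=
  [/\ univ_measurable_fun R Rs, {ae marginal P, forall x, E x (Rs x)} &
      (\int[marginal P]_x (cost L x (Rs x))%:E < +oo)%E].

(* P' is the law with the X-marginal of P and the kernel Rs *)
Definition glued M P (Rs : X -> pprobability W R) P' : Prop :=
  [/\ laws M P', same_law (marginal P') (marginal P) &
      {ae marginal P, forall x, same_law (kern M P' x) (Rs x)}].

(* The moments required by the model are a P_X-integrable target integrand and
   integrable outcomes in each arm. *)
Definition cost_conditions M L : Prop :=
  [/\ forall x Q, adm L x Q -> [/\ 1 <= cost L x Q,
        `|rd_psi L x Q| <= cost L x Q & forall a, arm_integrable Q a],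
      forall P, laws M P -> {ae marginal P, forall x, adm L x (kern M P x)} /\
        (\int[marginal P]_x (cost L x (kern M P x))%:E < +oo)%E &
      forall P Rs, laws M P -> selection L P (adm L) Rs ->
        exists P', glued M P Rs P'].

Definition local_readouts M L : Prop :=
  forall P, laws M P -> {ae marginal P, forall x,
    [/\ umean M P x = rd_u L x (kern M P x),
        pscore M P x = rd_pi L x (kern M P x),
        kappa M P x = rd_kappa L x (kern M P x) &
        maxu M P x = rd_psi L x (kern M P x)]}.

Definition standing_conditions M L : Prop :=
  [/\ borel_local_model L, closed_under_restriction M, cost_conditions M L &
      local_readouts M L].

(* Q' is Q_x^P with its arm-a law replaced by (1 - eps) Q_{x,a}^P + eps nu *)
Definition arm_perturbation M P (a : bool) (x : X) : set (pprobability W R) :=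
  [set Q' | exists (eps : R) (nu : probability R R) (F : set R),
    [/\ 0 < eps < 1,
        [/\ finite_set F, F `<=` supp (arm_law (kern M P x) a) & nu F = 1%E],
        ('E_nu[fun y => y] = (arm_coord (umean M P x) a)%:E)%E,
        forall B, measurable B -> (Q' : probability W R) ([set a] `*` B) =
          ((arm_coord (pscore M P x) a)%:E *
           ((1 - eps)%:E * arm_law (kern M P x) a B + eps%:E * nu B))%E &
        forall B, measurable B -> (Q' : probability W R) ([set ~~ a] `*` B) =
          (kern M P x : probability W R) ([set ~~ a] `*` B)]].

(* The second alternative of the selections is the baseline kernel, used where
   a perturbation is too costly. *)
Definition X1 M L P : Prop := forall a,
  [/\ measurable [set z : X * pprobability W R | arm_perturbation M P a z.1 z.2],
      {ae marginal P, forall x, arm_perturbation M P a x `<=` adm L x} &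
      forall Rs,
        selection L P (fun x => arm_perturbation M P a x `|`
            [set Q | same_law Q (kern M P x)]) Rs ->
        exists P', glued M P Rs P' /\
          {ae marginal P, forall x, [/\ umean M P' x = umean M P x,
             pscore M P' x = pscore M P x & kappa M P' x = kappa M P x]}].

(* D_x, R_P(x) (as the sets of the x such that a is in R_P(x)), eps_P(x) *)
Definition X2 M P (D : X -> set (R * R)) (RP : bool -> set X) (epsP : X -> R) :=
  [/\ measurable [set z : X * (R * R) | D z.1 z.2],
      forall a, measurable (RP a),
      measurable_fun setT epsP &
      {ae marginal P, forall x,
        [/\ D x (0, 0),
            forall a, RP a x -> ~~ arm_coord (kappa M P x) a,
            forall a, RP a x -> exists2 tau, 0 < tau & forall t, `|t| < tau ->
              ~~ arm_coord (argmax (umean M P x + arm_dir a t)) a ->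
              D x (arm_dir a t),
            0 < epsP x &
            forall t, `|t| < epsP x -> D x (set_dir (kappa M P x) t)]}].

(* The graph is that of (x, delta) |-> Qd x delta, up to [same_law]. *)
Definition X3 M L P (D : X -> set (R * R))
    (Qd : X -> R * R -> pprobability W R) :=
  [/\ measurable [set z : X * (R * R) * pprobability W R |
        D z.1.1 z.1.2 /\ same_law z.2 (Qd z.1.1 z.1.2)],
      {ae marginal P, forall x, same_law (Qd x (0, 0)) (kern M P x)},
      {ae marginal P, forall x delta, D x delta ->
        [/\ adm L x (Qd x delta),
            (Qd x delta : probability W R) `<< (kern M P x : probability W R),
            forall a, (Qd x delta : probability W R) (arm_set a) =
              (arm_coord (pscore M P x) a)%:E,
            forall a, arm_integrable (Qd x delta) a /\
              arm_mean (Qd x delta) a = arm_coord (umean M P x + delta) a &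
            argmax (umean M P x + delta) = kappa M P x]} &
      forall Rs, selection L P (fun x => [set Q | exists2 delta, D x delta &
          same_law Q (Qd x delta)]) Rs ->
        exists P', glued M P Rs P'].

Definition max_arm_conditions M L : Prop := forall P, laws M P ->
  X1 M L P /\ exists D RP epsP Qd, X2 M P D RP epsP /\ X3 M L P D Qd.

Definition sigma2 M P (x : X) (a : bool) : \bar R := arm_var (kern M P x) a.

Definition variance_conditions M P : Prop := {ae marginal P, forall x,
  (forall a, (sigma2 M P x a < +oo)%E) /\
  (forall a, arm_coord (kappa M P x) a -> (0 < sigma2 M P x a)%E)}.

(* sum over a in S(x) of pi_a(x) / s2_a *)
Definition precision M P (s2 : bool -> R) (x : X) : R :=
  \sum_(a : bool | arm_coord (kappa M P x) a)
    arm_coord (pscore M P x) a / s2 a.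

Definition lambda_star M P (x : X) (a : bool) : R :=
  if arm_coord (kappa M P x) a then
    arm_coord (pscore M P x) a / fine (sigma2 M P x a) /
    precision M P (fun b => fine (sigma2 M P x b)) x
  else 0.

Definition oracle M P (z : X * W) : R :=
  let: (x, (a, y)) := z in
  maxu M P x + (if arm_coord (kappa M P x) a then
    lambda_star M P x a / arm_coord (pscore M P x) a *
    (y - arm_coord (umean M P x) a)
  else 0).

Definition oracle_realization M P : Prop :=
  (exists f (w : X -> V), [/\ robust_class M f, measurable_fun setT w &
     {ae P, forall z, plug M f w P P z = oracle M P z}]) /\
  ('V_P[oracle M P] < +oo)%E.

(* the bound for conditional outcome variances s2 x a *)
Definition xu_guo_bound M P (s2 : X -> bool -> R) : \bar R :=
  ('V_(marginal P)[maxu M P] +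
   'E_(marginal P)[fun x => ((precision M P (s2 x) x)^-1)%R])%E.

End model.

(* Main.v *)
Require Import Defs.
From HB Require Import structures.
From mathcomp Require Import all_boot all_order all_algebra.
From mathcomp Require Import all_classical all_reals all_analysis measurable_realfun.
From mathcomp Require Import ring lra.
Set Implicit Arguments.
Unset Strict Implicit.
Unset Printing Implicit Defensive.
Import Order.TTheory GRing.Theory Num.Theory.
Import numFieldNormedType.Exports.
Local Open Scope classical_set_scope.
Local Open Scope ring_scope.

(** Restricting the law of the covariate shows that a robust score, plugged in at
    the true nuisances, has conditional mean [max_a u_a(x)] for almost every [x].
    Perturbing one arm law by two-point laws with the same mean, supported on
    quantiles of that arm law, does not change the nuisances, so the score must be
    affine in the outcome on each arm, with some slope [b_a(x)].  Shifting the means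
    of all the optimal arms by the same [t] with the scores frozen moves the
    conditional mean by [t * sum_(a in S) pi_a b_a] and the value [max_a u_a] by [t], which
    double robustness forces to agree: [sum_(a in S) pi_a b_a = 1].  By Cauchy-Schwarz
    the conditional variance, at least [sum_(a in S) pi_a sigma_a^2 b_a^2], is then at
    least [1 / sum_(a in S) pi_a / sigma_a^2], and the oracle score attains this bound.
    The shifted laws are only known to have a Borel graph; that they depend universally
    measurably on [x] rests on the measurability of projections, obtained here from the
    Souslin operation. *)

(** * Universal measurability of Souslin sets *)

(** The obstacle is that the hypotheses speak of glued laws, hence of one choice of perturbation at
    a time, each with its own exceptional null set of covariates, while affinity concerns
    uncountably many pairs of outcomes at a single covariate. Indexing outcomes by quantile levels
    resolves this: for each pair of levels the identity holds off a null set, Fubini exchanges the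
    quantifiers, and since quantiles push the uniform law to the arm law, almost every level means
    almost every outcome. Costs of perturbations need not be integrable, so a perturbation is used
    only where its cost is at most n, with the baseline kernel elsewhere, and n then runs over the
    naturals. Once the score is known to be affine, a single finite shift of the active arms, by
    half of the allowed range, determines the weighted sum of slopes exactly, and no derivative is
    taken. There the score is read along the shifted law with the nuisances of the original law,
    which is legitimate because the propensities agree. *)

Section souslin.
Context (R : realType) d (T : measurableType d).

Definition is_hull (mu : {finite_measure set T -> \bar R}) (S H : set T) :=
  [/\ measurable H, S `<=` H &
      forall C, measurable C -> S `<=` C -> mu (H `\` C) = 0%E].

(** Intersect a sequence of measurable supersets whose measures tend to the infimum. A further
    superset that removed positive mass from the intersection would push the measure below that
    infimum. *)
Lemma hull_exists (mu : {finite_measure set T -> \bar R}) S :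
  exists H, is_hull mu S H.
Proof.
pose A := [set fine (mu C) | C in [set C | measurable C /\ S `<=` C]].
have Alb : has_lbound A by exists 0 => _ [C _ <-]; exact: fine_ge0.
have Ainf : has_inf A by split=> //; exists (fine (mu setT)), setT.
have /choice[C HC] : forall n : nat, exists C, [/\ measurable C, S `<=` C &
    fine (mu C) < inf A + n.+1%:R^-1].
  move=> n; have n0 : 0 < (n.+1%:R^-1 : R) by rewrite invr_gt0.
  have [_ [C [mC SC] <-] lt] := inf_adherent n0 Ainf.
  by exists C.
have mC n : measurable (C n) by have [] := HC n.
pose H := \bigcap_n C n.
have mH : measurable H by exact: bigcapT_measurable.
have SH : S `<=` H by move=> x Sx n _; have [_ + _] := HC n; apply.
exists H; split=> // D mD SD.
have mHD : measurable (H `&` D) by exact: measurableI.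
have SHD : S `<=` H `&` D by move=> x Sx; split; [exact: SH|exact: SD].
have h1 : inf A <= fine (mu (H `&` D)).
  by apply: (ge_inf Alb); exists (H `&` D).
have h2 : fine (mu H) <= inf A.
  apply/ler_addgt0Pr => e e0.
  have [n ne] : exists n : nat, n.+1%:R^-1 < e.
    by exists (Num.truncn e^-1); rewrite invf_plt ?posrE// truncnS_gt.
  have [_ _ lt] := HC n.
  apply: (@le_trans _ _ (fine (mu (C n)))); last by apply/ltW/(lt_trans lt); rewrite ltrD2l.
  rewrite fine_le ?fin_num_measure// le_measure ?inE//.
  exact: bigcap_inf.
have : (mu H = mu (H `\` D) + mu (H `&` D))%E.
  by rewrite -(measureDI mu mH mD).
have f1 : mu (H `\` D) \is a fin_num by rewrite fin_num_measure//; exact: measurableD.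
have f2 : mu (H `&` D) \is a fin_num by rewrite fin_num_measure.
have f3 : mu H \is a fin_num by rewrite fin_num_measure.
move=> e; move: h2; rewrite e fineD// => h2.
have h3 : fine (mu (H `\` D)) <= 0 by rewrite -(lerD2r (fine (mu (H `&` D)))) add0r (le_trans h2).
apply/eqP; rewrite eq_le measure_ge0 andbT -(fineK f1) lee_fin//.
Qed.

(** The Souslin operation on a scheme of measurable sets. The alphabet is any countable type, so
    that two sequences of naturals can later be read as one branch of pairs. *)
Definition souslin (I : countType) (A : set T) := exists E : seq I -> set T,
  (forall s, measurable (E s)) /\
  A = [set x | exists z : nat -> I, forall k, E (mkseq z k) x].

(* Szpilrajn-Marczewski: replacing the sets of the scheme by measurable hulls
   of the partial results changes only a null set. *)
Lemma souslin_univ (I : countType) (A : set T) :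
  souslin I A -> univ_measurable R A.
Proof.
move=> [E [mE ->]] mu.
(* The points having a branch that starts with [s]; the empty prefix gives the whole set. *)
pose A_ s := [set x | exists z : nat -> I,
  mkseq z (size s) = s /\ forall k, E (mkseq z k) x].
have /choice[G HG] : forall s, exists H, is_hull mu (A_ s) H.
  by move=> s; exact: hull_exists.
pose H s := G s `&` E s.
have mG s : measurable (G s) by have [] := HG s.
have mH s : measurable (H s) by exact: measurableI.
have AH s : A_ s `<=` H s.
  move=> x [z [zs Ex]]; split; last by rewrite -zs.
  by have [_ + _] := HG s; apply; exists z.
pose U s := \bigcup_(n in setT) if (unpickle n : option I) is Some i then H (rcons s i) else set0.
have mU s : measurable (U s).
  by apply: bigcup_measurable => n _; case: unpickle.
have AU s : A_ s `<=` U s.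
  move=> x [z [zs Ex]]; exists (pickle (z (size s))) => //=.
  rewrite pickleK; apply: AH; exists z; split=> //.
  by rewrite size_rcons mkseqS zs.
have [os osK] : exists os : nat -> option (seq I), pcancel pickle os.
  by exists unpickle; exact: pickleK.
(* The points lying in the hull of some prefix but in the hull of none of its one-letter extensions.
   Each piece is null by minimality of the hull, and there are countably many prefixes; off [N]
   every prefix whose hull contains the point can be extended. *)
pose N := \bigcup_(n in setT) if os n is Some s then H s `\` U s else set0.
have mN : measurable N.
  by apply: bigcup_measurable => n _; case: (os n) => // s; exact: measurableD.
have N0 : mu N = 0%E.
  apply/negligibleP => //; apply: negligible_bigcup => n.
  case: (os n) => [s|]; last exact: negligible_set0.
  apply/negligibleP; first exact: measurableD.
  apply/eqP; rewrite eq_le measure_ge0 andbT.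
  have [_ _ h] := HG s.
  rewrite -(h _ (mU s) (AU s)) le_measure ?inE//; [exact: measurableD|exact: measurableD|].
  by apply: setSD => x [].
exists (H [::] `\` N), (H [::]); split=> //.
- exact: measurableD.
- move=> x [H0 Nx].
  have step s : H s x -> exists i, H (rcons s i) x.
    move=> Hs; have : U s x.
      apply: contrapT => Us; apply: Nx; exists (pickle s) => //=.
      by rewrite osK.
    by move=> [n _]; case: unpickle => // i Hi; exists i.
  (* The successor is chosen for all prefixes at once, with an arbitrary value where [H s x] fails;
     only the iterates from the empty prefix are used. *)
  have /choice[nx Hnx] : forall s, exists s', H s x -> H s' x /\ exists i, s' = rcons s i.
    move=> s; have [Hs|Hs] := pselect (H s x); last by exists s.
    by have [i Hi] := step _ Hs; exists (rcons s i) => _; split=> //; exists i.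
  pose S n := iter n nx [::].
  have HS n : H (S n) x by elim: n => //= n /Hnx[].
  have SS n : exists i, S n.+1 = rcons (S n) i by have [] := Hnx _ (HS n).
  have /choice[z Hz] := SS.
  exists z => k.
  suff -> : mkseq z k = S k by have [] := HS k.
  elim: k => // k ih; by rewrite mkseqS Hz -ih.
- by move=> x [z Ez]; apply: AH; exists z.
- rewrite setDD; apply/eqP; rewrite eq_le measure_ge0 andbT -N0 le_measure ?inE//.
  exact: measurableI.
Qed.

End souslin.

(** * Measurable projection along the Baire space *)

Definition cylinders : set (set (nat -> nat)) :=
  [set B | exists i j : nat, B = [set z | z i = j]].

Definition baire : measurableType _ := g_sigma_algebraType cylinders.

Section projection.
Context (R : realType) d (X : measurableType d).

(** A Souslin scheme on the product that reads the point [z] only through its finite prefixes, next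
    to those of a witness [y]. In this form, quantifying over [z] merely enlarges the witness. *)
Definition baire_souslin (G : set (X * baire)) :=
  exists E : seq nat -> seq nat -> set X, (forall s t, measurable (E s t)) /\
  forall x z, G (x, z) <->
    exists y : nat -> nat, forall k, E (mkseq z k) (mkseq y k) x.

Lemma mkseq_take (f : nat -> nat) k l : (k <= l)%N -> take k (mkseq f l) = mkseq f k.
Proof.
move=> kl; rewrite /mkseq -map_take take_iota.
by move/minn_idPl: kl => ->.
Qed.

Lemma eq_mkseq_in (f g : nat -> nat) k :
  (forall j, (j < k)%N -> f j = g j) -> mkseq f k = mkseq g k.
Proof. by move=> fg; apply/eq_in_map => j; rewrite mem_iota => /fg. Qed.

Lemma mkseq_cons (f : nat -> nat) k :
  mkseq f k.+1 = f 0%N :: mkseq (fun i => f i.+1) k.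
Proof. by rewrite /mkseq /= -[1%N]/(1 + 0)%N iotaDl -map_comp. Qed.

(** The first letter of the witness names the index and the rest is a witness for that index. The
    prefix of [z] is cut to the length of this shifted witness. *)
Lemma baire_souslin_bigcup (F : nat -> set (X * baire)) :
  (forall i, baire_souslin (F i)) -> baire_souslin (\bigcup_i F i).
Proof.
move=> /choice[E HE].
have [G [G0 GE]] : exists G : seq nat -> seq nat -> set X,
    (forall s, G s [::] = setT) /\
    forall s i t, G s (i :: t) = E i (take (size t) s) t.
  by exists (fun s t => if t is i :: t' then E i (take (size t') s) t' else setT).
exists G; split.
  by move=> s [|i t]; rewrite ?G0// GE; have [] := HE i.
move=> x z; split.
- move=> [i _ /(HE i).2[y Hy]].
  exists (fun n => if n is n'.+1 then y n' else i) => -[|k]; first by rewrite G0.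
  by rewrite (mkseq_cons (fun n => if n is n'.+1 then y n' else i)) GE size_mkseq mkseq_take.
- move=> [y Hy]; exists (y 0%N) => //; apply/(HE _).2.
  exists (fun n => y n.+1) => k; have := Hy k.+1.
  by rewrite (mkseq_cons y) GE size_mkseq mkseq_take.
Qed.

(** One sequence stores the witnesses of all indices, letter j of witness i at position [c i j]. A
    condition is imposed only when the current prefixes are long enough to contain every letter it
    reads, and is the whole space before that. *)
Lemma baire_souslin_bigcap (F : nat -> set (X * baire)) :
  (forall i, baire_souslin (F i)) -> baire_souslin (\bigcap_i F i).
Proof.
move=> /choice[E HE].
pose c (i j : nat) : nat := pickle (i, j).
pose Q (s t : seq nat) (i k : nat) := (k <= size s)%N /\ forall j, (j < k)%N -> (c i j < size t)%N.
pose D (s t : seq nat) (i k : nat) : set X := if asbool (Q s t i k)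
  then E i (take k s) (mkseq (fun j => nth 0%N t (c i j)) k) else setT.
exists (fun s t => \bigcap_i \bigcap_k D s t i k).
split.
  move=> s t; apply: bigcapT_measurable => i; apply: bigcapT_measurable => k.
  by rewrite /D; case: ifP => _ //; have [] := HE i.
move=> x z; split.
- move=> FH.
  have /choice[y Hy] : forall i, exists y, forall k, E i (mkseq z k) (mkseq y k) x.
    by move=> i; apply/(HE i).2; exact: FH.
  pose w n := if unpickle n is Some ij then y ij.1 ij.2 else 0%N.
  exists w => l i _ k _; rewrite /D; case: ifP => // /asboolP[].
  rewrite !size_mkseq => kl ct; rewrite mkseq_take//.
  have -> : mkseq (fun j => nth 0%N (mkseq w l) (c i j)) k = mkseq (y i) k.
    by apply: eq_mkseq_in => j jk; rewrite nth_mkseq ?ct// /w pickleK.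
  exact: Hy.
- move=> [w Hw] i _; apply/(HE i).2; exists (fun j => w (c i j)) => k.
  (* A length at which the guard [Q] holds for [i] and [k]: it covers [k] letters of [z] and all
     positions [c i j] with j below [k]. *)
  pose l := maxn k (\max_(j < k) (c i j).+1).
  have kl : (k <= l)%N by rewrite leq_maxl.
  have cl j : (j < k)%N -> (c i j < l)%N.
    by move=> jk; rewrite leq_max; apply/orP; right; exact: (leq_bigmax (Ordinal jk)).
  have := Hw l i I k I; rewrite /D; case: asboolP; last first.
    by case; split; rewrite !size_mkseq.
  move=> _; rewrite mkseq_take//.
  have -> // : mkseq (fun j => nth 0%N (mkseq w l) (c i j)) k = mkseq (fun j => w (c i j)) k.
  by apply: eq_mkseq_in => j jk; rewrite nth_mkseq ?cl.
Qed.

Lemma baire_souslin_fst (A : set X) : measurable A ->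
  baire_souslin [set xz | A xz.1].
Proof.
move=> mA; exists (fun _ _ => A); split=> // x z; split=> [Ax|[y]]; last by apply; exact: 0%N.
by exists z.
Qed.

Lemma baire_souslin_snd (i : nat) (C : set nat) :
  baire_souslin [set xz : X * baire | C (xz.2 i)].
Proof.
exists (fun s _ => [set x | (i < size s)%N -> C (nth 0%N s i)]); split.
  move=> s _; have [h|h] := pselect ((i < size s)%N -> C (nth 0%N s i)).
    by rewrite (_ : [set _ | _] = setT)//; apply/seteqP; split.
  by rewrite (_ : [set _ | _] = set0)//; apply/seteqP; split.
move=> x z; split=> /=.
  by move=> Cz; exists z => k; rewrite size_mkseq => ik; rewrite nth_mkseq.
by move=> [y /(_ i.+1)]; rewrite size_mkseq nth_mkseq//; apply.
Qed.

(** Souslin sets need not be closed under complement. Imposing the property on a set and on its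
    complement gives a sigma-algebra, to which an induction on generators applies. *)
Definition baire_bisouslin (G : set (X * baire)) :=
  baire_souslin G /\ baire_souslin (~` G).

Lemma baire_bisouslin_sigma_algebra : sigma_algebra setT baire_bisouslin.
Proof.
split.
- split; first by have := baire_souslin_fst measurable0; rewrite (_ : [set _ | _] = set0).
  rewrite setC0 (_ : setT = [set xz : X * baire | [set: X] xz.1])//.
  exact: baire_souslin_fst.
- by move=> G [G1 G2]; rewrite setTD; split=> //; rewrite setCK.
- move=> F HF; split.
    by apply: baire_souslin_bigcup => i; have [] := HF i.
  by rewrite setC_bigcup; apply: baire_souslin_bigcap => i; have [] := HF i.
Qed.

Lemma measurable_bisouslin (G : set (X * baire)) :
  measurable G -> baire_bisouslin G.
Proof.
have [b0 bC bU] := baire_bisouslin_sigma_algebra.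
have bC' H : baire_bisouslin H -> baire_bisouslin (~` H).
  by move=> /bC; rewrite setTD.
have bI A B : baire_bisouslin A -> baire_bisouslin B -> baire_bisouslin (A `&` B).
  move=> /bC' hA /bC' hB; rewrite -[_ `&` _]setCK setCI; apply: bC'.
  rewrite -bigcup2E; apply: bU => -[|[|n]]//=.
rewrite measurable_prod_measurableType.
move: G; apply: smallest_sub.
  exact: baire_bisouslin_sigma_algebra.
move=> _ [A mA [B mB <-]].
rewrite (_ : A `*` B = [set xz : X * baire | A xz.1] `&` [set xz | B xz.2])//.
apply: bI.
  split; first exact: baire_souslin_fst.
  by have := baire_souslin_fst (measurableC mA).
suff : measurable `<=` [set B : set baire | baire_bisouslin [set xz | B xz.2]] by exact.
apply: smallest_sub.
  split.
  - by rewrite /= (_ : [set _ | _] = set0)//.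
  - by move=> C; rewrite setTD => /bC'.
  - move=> F HF; have := bU _ HF; rewrite (_ : \bigcup_k _ = [set xz | (\bigcup_k F k) xz.2])//.
move=> _ [i [j ->]]; split; first exact: (baire_souslin_snd i [set j]).
exact: (baire_souslin_snd i (~` [set j])).
Qed.

(** The projected-out point and the witness form a single branch over pairs of naturals, so the
    projection is a Souslin set of [X] itself. *)
Lemma baire_projection (G : set (X * baire)) : measurable G ->
  univ_measurable R [set x | exists z, G (x, z)].
Proof.
move=> /measurable_bisouslin[[E [mE HE]] _].
apply: (@souslin_univ R d X (nat * nat)%type).
exists (fun s => E (unzip1 s) (unzip2 s)); split=> //.
have u1 (p : nat -> nat * nat) k : unzip1 (mkseq p k) = mkseq (fun i => (p i).1) k.
  by rewrite /unzip1 /mkseq -map_comp.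
have u2 (p : nat -> nat * nat) k : unzip2 (mkseq p k) = mkseq (fun i => (p i).2) k.
  by rewrite /unzip2 /mkseq -map_comp.
apply/seteqP; split=> x /=.
  move=> [z /HE[y Hy]]; exists (fun i => (z i, y i)) => k.
  by rewrite u1 u2; exact: Hy.
move=> [p Hp]; exists (fun i => (p i).1); apply/HE; exists (fun i => (p i).2) => k.
by have := Hp k; rewrite u1 u2.
Qed.

End projection.

(** * Quantile representation of real laws *)

Lemma measurable_pprob (R : realType) d d' (T : measurableType d)
    (Y : measurableType d') (f : T -> pprobability Y R) :
  (forall U, measurable U ->
    measurable_fun setT (fun x => (f x : probability Y R) U)) ->
  measurable_fun setT f.
Proof.
move=> mf; apply: (@measurability _ _ T (pprobability Y R) setT f (@pset _ Y R)) => //.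
move=> _ [_ [r r01 [U mU <-]] <-]; rewrite setTI.
rewrite (_ : _ @^-1` _ = (fun x => (f x : probability Y R) U) @^-1` `]-oo, r%:E[%classic).
  by rewrite -[X in measurable X]setTI; apply: mf => //; exact: emeasurable_itv.
by apply/seteqP; split=> x /=; rewrite in_itv.
Qed.

Lemma measurable_pprob_eval (R : realType) d d' (T : measurableType d)
    (Y : measurableType d') (f : T -> pprobability Y R) U :
  measurable_fun setT f -> measurable U ->
  measurable_fun setT (fun x => (f x : probability Y R) U).
Proof. by move=> mf mU; exact: (measurable_kernel (kprobability mf)). Qed.

(** The generators of the sigma-algebra on laws only evaluate laws at measurable sets. This replaces
    rewriting, since laws agreeing on measurable sets need not be Leibniz equal. *)
Lemma same_law_measurable (R : realType) d (Y : measurableType d)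
    (B : set (pprobability Y R)) (Q Q' : pprobability Y R) :
  measurable B -> same_law Q Q' -> B Q -> B Q'.
Proof.
move=> mB QQ'; suff [] : B Q <-> B Q' by [].
suff : measurable `<=` [set B : set (pprobability Y R) | B Q <-> B Q'] by exact.
apply: smallest_sub.
  split=> //.
  - by move=> C /= [h1 h2]; split=> -[_ nC]; split=> // hC; apply: nC; [exact: h2|exact: h1].
  - by move=> F HF; split=> -[i _ /(HF i)]; exists i.
by move=> _ [r _ [U mU <-]]; rewrite /mset /= QQ'.
Qed.

Section quantile.
Context (R : realType).

Definition rational (n : nat) : R := if unpickle n is Some r then ratr r else 0.

Lemma rational_between (a b : R) : a < b -> exists n, a < rational n < b.
Proof.
move=> ab; have [r rab] := rat_in_itvoo ab.
by exists (pickle r); rewrite /rational pickleK; move: rab; rewrite in_itv.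
Qed.

(** [F n] stands for a distribution function at the n-th rational. The supremum over rationals only
    is what makes the quantile jointly measurable in its level and in a parameter of [F]; rationals
    failing the test contribute the neutral value -oo. *)
Definition quantile (F : nat -> \bar R) (u : R) : R :=
  fine (ereal_sup (range (fun n => if (F n < u%:E)%E then (rational n)%:E else -oo%E))).

Lemma measurable_quantile d (T : measurableType d) (F : nat -> T -> \bar R) :
  (forall n, measurable_fun setT (F n)) ->
  measurable_fun setT (fun tu : T * R => quantile (F ^~ tu.1) tu.2).
Proof.
move=> mF.
pose g (n : nat) (tu : T * R) : \bar R := if (F n tu.1 < (tu.2)%:E)%E then (rational n)%:E else -oo%E.
apply: measurableT_comp => //.
rewrite (_ : (fun _ => _) = fun tu => esups (g ^~ tu) 0%N).
  apply: measurable_fun_esups => n.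
  apply: measurable_fun_if => //.
  apply: measurable_fun_lte; first exact: measurableT_comp.
  by apply/measurable_EFinP.
apply/funext => tu; rewrite /esups /= /sdrop; congr ereal_sup.
by apply/seteqP; split=> x [n _ <-]; exists n.
Qed.

Let idR : R -> R := idfun.
HB.instance Definition _ := @isMeasurableFun.Build _ _ _ _ idR (@measurable_id _ _ setT).

Section law.
Variable mu : probability R R.
Let F n := mu `]-oo, rational n]%classic.

(** The Galois connection between quantile and distribution function. Right continuity yields a
    rational beyond [c] still below level [u], and the limits at both infinities make the supremum
    finite, so that [fine] loses nothing. *)
Lemma quantile_le (u c : R) : 0 < u < 1 ->
  (quantile F u <= c) = (u%:E <= mu `]-oo, c]%classic)%E.
Proof.
move=> /andP[u0 u1].
pose X : {RV mu >-> R} := idR.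
have cdfE r : cdf X r = mu `]-oo, r]%classic by [].
pose S := range (fun n => if (F n < u%:E)%E then (rational n)%:E else -oo%E).
have mono r s : r <= s -> (mu `]-oo, r]%classic <= mu `]-oo, s]%classic)%E.
  by move=> rs; rewrite le_measure ?inE//; apply: subset_itvl; rewrite bnd_simp.
have Sub r : (u%:E <= mu `]-oo, r]%classic)%E -> (ereal_sup S <= r%:E)%E.
  move=> ur; apply: ub_ereal_sup => _ [n _ <-]; case: ifP => Fu; last by rewrite leNye.
  rewrite lee_fin leNgt; apply/negP => rq; have := lt_le_trans Fu ur.
  by rewrite ltNge mono// ltW.
have Slb k : (F k < u%:E)%E -> ((rational k)%:E <= ereal_sup S)%E.
  by move=> Fn; apply: ereal_sup_ubound; exists k; rewrite ?Fn.
have rc r : (mu `]-oo, r]%classic < u%:E)%E -> exists n, r < rational n /\ (F n < u%:E)%E.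
  move=> ru; have rcv : cdf X @ r^'+ --> cdf X r := @cdf_right_continuous _ _ _ mu X r.
  have := rcv _ (open_ereal_lt' ru).
  rewrite /at_right /within /nbhs /= => -[e /= e0 He].
  have rre : r < r + e by rewrite ltrDl.
  have [n /andP[n1 n2]] := rational_between rre.
  exists n; split=> //; apply: (He (rational n)) => //=.
  by rewrite distrC ger0_norm ?subr_ge0 ?(ltW n1)// ltrBlDl.
have [r0 hr0] : exists r, (mu `]-oo, r]%classic < u%:E)%E.
  have h : \forall s \near -oo%R, (cdf X s < u%:E)%E.
    by apply: (@cvg_cdfNy0 _ _ _ mu X _ (open_ereal_lt' _)); rewrite lte_fin.
  by have [r hr] := filter_ex h; exists r.
have [r1 hr1] : exists r, (u%:E <= mu `]-oo, r]%classic)%E.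
  have h : \forall s \near +oo%R, (u%:E < cdf X s)%E.
    by apply: (@cvg_cdfy1 _ _ _ mu X _ (open_ereal_gt' _)); rewrite lte_fin.
  by have [r /ltW hr] := filter_ex h; exists r.
have Sfin : ereal_sup S \is a fin_num.
  have [n [_ /Slb hn]] := rc _ hr0.
  rewrite fin_numElt (lt_le_trans _ hn) ?ltNyr//=.
  by rewrite (le_lt_trans (Sub _ hr1)) ?ltry.
apply/idP/idP; last first.
  by move=> /Sub h; rewrite /quantile -/S -lee_fin fineK.
apply: contraLR; rewrite -ltNge -ltNge => /rc[n [cn /Slb]].
rewrite -[ereal_sup _]fineK// lee_fin => h.
exact: lt_le_trans h.
Qed.

End law.

Let idL : measurableTypeR R -> R := idfun.
Let measurable_idL : measurable_fun setT idL.
Proof. by move=> _ B mB; rewrite setTI. Qed.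
HB.instance Definition _ := @isMeasurableFun.Build _ _ _ _ idL measurable_idL.

(** The push-forward along [idL] only changes the measurable structure recorded in the type of the
    line. *)
Definition unif : probability R R := distribution (uniform_prob (@ltr01 R)) idL.

Lemma unif_itv (U : set R) : measurable U -> unif U = lebesgue_measure (U `&` `[0, 1]%classic).
Proof.
move=> mU; rewrite /unif /distribution /pushforward /= /uniform_prob integral_uniform_pdf.
rewrite (eq_integral (cst 1%E)); last first.
  by move=> x; rewrite inE => -[_ /=]; rewrite in_itv /= /uniform_pdf => ->; rewrite subr0 invr1.
by rewrite integral_cst ?mul1e//; exact: measurableI.
Qed.

Lemma unif_oo : unif `]0, 1[%classic = 1%E.
Proof.
rewrite unif_itv// setIidl; last by apply: subset_itv; rewrite bnd_simp.
by rewrite lebesgue_measure_itv /= lte_fin ltr01 oppr0 adde0.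
Qed.

Lemma unif_le (p : R) : 0 <= p <= 1 -> unif [set u | u <= p] = p%:E.
Proof.
move=> /andP[p0 p1]; rewrite unif_itv; last by rewrite -set_itvNyc.
rewrite (_ : _ `&` _ = `[0, p]%classic).
  rewrite lebesgue_measure_itv /= lte_fin.
  by case: ltP => [_|p0']; rewrite ?oppr0 ?adde0//; congr EFin; apply/eqP; rewrite eq_le p0 p0'.
apply/seteqP; split=> u /=; rewrite !in_itv /=; first by move=> [-> /andP[->]].
by move=> /andP[-> up]; rewrite up (le_trans up p1).
Qed.

Lemma unif_setI_oo (C : set R) : measurable C ->
  unif C = unif (C `&` `]0, 1[%classic).
Proof.
move=> mC; have mI : measurable `]0%R, (1 : R)[%classic by exact: measurable_itv.
rewrite [LHS](measureDI unif mC mI).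
rewrite [X in (X + _)%E](_ : _ = 0%E) ?add0e//; apply/eqP; rewrite -measure_le0.
have <- : unif (~` `]0, 1[%classic) = 0%E by rewrite probability_setC// unif_oo subee.
apply: le_measure; rewrite ?inE; [exact: measurableD|exact: measurableC|by move=> u []].
Qed.

(** Inverse transform sampling. By [quantile_le] the two laws agree on left half-lines, hence on the
    open right half-lines, which generate the Borel sets and are stable under intersection. *)
Lemma quantile_law (mu : probability R R) (B : set R) : measurable B ->
  unif [set u | B (quantile (fun n => mu `]-oo, rational n]%classic) u)] = mu B.
Proof.
move=> mB; pose F n := mu `]-oo, rational n]%classic; rewrite -/F.
have mq : measurable_fun setT (quantile F).
  have h := @measurable_quantile _ unit (fun n _ => F n) (fun n => measurable_cst _).
  exact: (measurableT_comp h (measurable_pair1 tt)).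
have mqC C : measurable C -> measurable (quantile F @^-1` C).
  by move=> mC; rewrite -[X in measurable X]setTI; exact: mq.
pose Y : {mfun R >-> R} := HB.pack_for {mfun R >-> R} (quantile F)
  (@isMeasurableFun.Build _ _ _ _ _ mq).
suff : (distribution unif Y : probability R R) B = mu B by [].
have Fle c : distribution unif Y `]-oo, c]%classic = mu `]-oo, c]%classic.
  have p01 : 0 <= fine (mu `]-oo, c]%classic) <= 1.
    by rewrite -!lee_fin fineK ?fin_num_measure// measure_ge0 probability_le1.
  rewrite -[RHS]fineK ?fin_num_measure// -(unif_le p01).
  rewrite /distribution /pushforward unif_setI_oo; last by apply: mqC; exact: measurable_itv.
  rewrite [RHS]unif_setI_oo; last by rewrite -set_itvNyc.
  congr (unif _); apply/seteqP; split=> u /=; rewrite !in_itv /= => -[uq u01]; split=> //.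
    by move: uq; rewrite quantile_le// -lee_fin fineK ?fin_num_measure.
  by rewrite quantile_le//; move: uq; rewrite -lee_fin fineK ?fin_num_measure.
have Fgt x : distribution unif Y `]x, +oo[%classic = mu `]x, +oo[%classic.
  have -> : `]x, +oo[%classic = ~` `]-oo, x]%classic by rewrite setCitvl.
  by rewrite !probability_setC//; congr (_ - _)%E; exact: Fle.
apply: (measure_unique (@RGenOInfty.G R) (fun n => `](- n%:R), +oo[%classic)) => //.
- exact: RGenOInfty.measurableE.
- move=> _ _ [x ->] [y ->]; exists (Num.max x y).
  by apply/seteqP; split=> z /=; rewrite !in_itv /= !andbT gt_max => /andP.
- by move=> n; exists (- n%:R).
- rewrite -subTset => x _; exists (Num.truncn (- x)).+1 => //=.
  by rewrite in_itv /= andbT ltrNl truncnS_gt.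
- by move=> _ [x ->]; exact: Fgt.
- by move=> k; rewrite (le_lt_trans (probability_le1 _ _))// ltry.
Qed.

(** The distribution function is below [u] to the left of the quantile and at least [u] to its
    right, so each neighbourhood has mass. This makes two-point laws on quantiles admissible, as
    admissible perturbations must sit on the support. *)
Lemma quantile_supp (mu : probability R R) (u : R) : 0 < u < 1 ->
  supp mu (quantile (fun n => mu `]-oo, rational n]%classic) u).
Proof.
move=> u01 U oU; set q := quantile _ _ => Uq.
have [e /= e0 He] := open_nbhs_nbhs (conj oU Uq).
pose a := q - e / 2; pose b := q + e / 2.
have ab : a < b by rewrite /a /b; lra.
have h1 : (u%:E <= mu `]-oo, b]%classic)%E.
  by rewrite -quantile_le// /b -/q; lra.
have h2 : (mu `]-oo, a]%classic < u%:E)%E.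
  by rewrite ltNge -quantile_le// -ltNge /a -/q; lra.
have : (0 < mu `]a, b]%classic)%E.
  have -> : `]a, b]%classic = `]-oo, b]%classic `\` `]-oo, a]%classic.
    apply/seteqP; split=> y /=; rewrite !in_itv /=.
      by move=> /andP[h ->]; split=> //; apply/negP; rewrite -ltNge.
    by move=> [-> /negP]; rewrite -ltNge => ->.
  rewrite measureD//=; last by rewrite -ge0_fin_numE// fin_num_measure.
  rewrite setIidr; last by apply: subset_itvl; rewrite bnd_simp ltW.
  by rewrite sube_gt0; exact: lt_le_trans h1.
move=> /lt_le_trans; apply; apply: le_measure; rewrite ?inE//; first exact: open_measurable.
move=> y /=; rewrite in_itv /= => /andP[y1 y2]; apply: He => /=.
by move: y1 y2; rewrite /a /b ltr_norml => *; apply/andP; split; lra.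
Qed.

End quantile.

(** * Measurable projection along the laws of an observation *)

Section pushforward_unif.
Context (R : realType) d d' (T : measurableType d) (Y : measurableType d').
Variable phi : T * R -> Y.
Hypothesis mphi : measurable_fun setT phi.

Let sec (t : T) (u : R) := phi (t, u).
Let msec t : measurable_fun setT (sec t).
Proof. exact: measurableT_comp (measurable_pair1 t). Qed.
HB.instance Definition _ t := @isMeasurableFun.Build _ _ _ _ (sec t) (msec t).

Definition unif_image (t : T) : pprobability Y R := distribution (unif R) (sec t).

Lemma unif_imageE t U : (unif_image t : probability Y R) U = unif R [set u | U (phi (t, u))].
Proof. by []. Qed.

Lemma measurable_unif_image : measurable_fun setT unif_image.
Proof.
apply: measurable_pprob => U mU.
rewrite (_ : (fun _ => _) = fun t => unif R (xsection (phi @^-1` U) t)).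
  apply: measurable_fun_xsection.
  by rewrite -[X in measurable X]setTI; exact: mphi.
apply/funext => t; rewrite unif_imageE; congr (unif R _).
by apply/seteqP; split=> u; rewrite /xsection /= inE.
Qed.

End pushforward_unif.

Section projection.
Context (R : realType).
Local Notation obs := (obs R).

(** Encodes an observation as one real, the arm in the sign and the outcome in the logarithm of the
    modulus, so that laws of observations become laws on the line. *)
Definition obs_real (v : obs) : R := if v.1 then expR v.2 else - expR v.2.

Definition real_obs (r : R) : obs := (0 < r, ln `|r|).

Lemma obs_realK : cancel obs_real real_obs.
Proof.
move=> [[] y]; rewrite /obs_real /real_obs /=.
  by rewrite expR_gt0 ger0_norm ?expR_ge0// expRK.
by rewrite oppr_gt0 ltNge expR_ge0 /= normrN ger0_norm ?expR_ge0// expRK.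
Qed.

Lemma measurable_obs_real : measurable_fun setT obs_real.
Proof.
apply: measurable_fun_if => //=.
- apply: (@measurable_funS _ _ _ _ setT) => //.
  by apply: measurableT_comp => //; exact: measurable_expR.
- apply: (@measurable_funS _ _ _ _ setT) => //.
  apply: measurableT_comp => //; apply: measurableT_comp => //; exact: measurable_expR.
Qed.

HB.instance Definition _ := @isMeasurableFun.Build _ _ _ _ obs_real measurable_obs_real.

Lemma measurable_real_obs : measurable_fun setT real_obs.
Proof.
apply/measurable_fun_pairP; split.
  exact: measurable_fun_ltr.
exact: (measurableT_comp (@measurable_ln R) (@normr_measurable R setT)).
Qed.

(** The sequence is read as a table over pairs: a nonzero entry at (n, k) asserts that the
    distribution function at the n-th rational is at most the k-th rational. An arbitrary table need
    not describe a distribution function, but its quantile image is still a law. *)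
Definition baire_cdf (n : nat) (z : baire) : \bar R :=
  ereal_inf (range (fun k => if z (pickle (n, k)) == 0%N then +oo%E else (rational R k)%:E)).

Lemma measurable_baire_coord i : measurable_fun setT (fun z : baire => z i).
Proof.
move=> _ B _; rewrite setTI.
rewrite (_ : _ @^-1` _ = \bigcup_(j in B) [set z : baire | z i = j]).
  apply: bigcup_measurable => j _; apply: sub_sigma_algebra.
  by exists i, j.
by apply/seteqP; split=> [z Bz|z [j Bj zj]]; [exists (z i)|rewrite /preimage /= zj].
Qed.

Lemma measurable_baire_cdf n : measurable_fun setT (baire_cdf n).
Proof.
pose g (k : nat) (z : baire) : \bar R := if z (pickle (n, k)) == 0%N then +oo%E else (rational R k)%:E.
rewrite (_ : baire_cdf n = fun z => einfs (g ^~ z) 0%N).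
  apply: measurable_fun_einfs => k.
  apply: measurable_fun_if => //.
  apply: (measurableT_comp (f := fun m : nat => m == 0%N)) => //.
  exact: measurable_baire_coord.
apply/funext => z; rewrite /einfs /= /sdrop; congr ereal_inf.
by apply/seteqP; split=> x [k _ <-]; exists k.
Qed.

Let param_fun (zu : baire * R) : obs := real_obs (quantile (baire_cdf ^~ zu.1) zu.2).
Let measurable_param_fun : measurable_fun setT param_fun.
Proof.
apply: measurableT_comp; first exact: measurable_real_obs.
exact: (measurable_quantile measurable_baire_cdf).
Qed.

Definition pprob_param : baire -> pprobability obs R := unif_image measurable_param_fun.

(** Tabulate the distribution function of the image of [Q] on the line; the quantile transform
    followed by [real_obs] restores [Q] on measurable sets. *)
Lemma pprob_param_surj (Q : pprobability obs R) :
  exists z, same_law Q (pprob_param z).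
Proof.
pose mu : probability R R := distribution Q obs_real.
pose z (i : nat) : nat :=
  if (unpickle i : option (nat * nat)) is Some nk then
    (mu `]-oo, rational R nk.1]%classic <= (rational R nk.2)%:E)%E : nat
  else 0%N.
exists z => U mU.
have zE n : baire_cdf n z = mu `]-oo, rational R n]%classic.
  apply/eqP; rewrite eq_le; apply/andP; split.
    apply/lee_addgt0Pr => e e0.
    pose m := fine (mu `]-oo, rational R n]%classic).
    have mE : mu `]-oo, rational R n]%classic = m%:E by rewrite fineK// fin_num_measure.
    have me : m < m + e by rewrite ltrDl.
    have [k /andP[k1 k2]] := rational_between me.
    rewrite mE; apply: (@le_trans _ _ (rational R k)%:E); last by rewrite -EFinD lee_fin ltW.
    apply: ereal_inf_lbound; exists k => //.
    by rewrite /z pickleK /= mE lee_fin ltW.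
  apply: le_ereal_inf_tmp => _ [k _ <-]; rewrite /z pickleK /=.
  by case: ifP => [_|]; rewrite ?leey//; case: (_ <= _)%E.
rewrite /pprob_param unif_imageE /param_fun /=.
rewrite (_ : baire_cdf ^~ z = fun n => mu `]-oo, rational R n]%classic); last exact/funext.
rewrite (@quantile_law R mu (real_obs @^-1` U)); last first.
  by rewrite -[X in measurable X]setTI; exact: measurable_real_obs.
rewrite /mu /distribution /pushforward; congr (Q _).
by apply/seteqP; split=> v /=; rewrite obs_realK.
Qed.

(** Pull [H] back along the parametrization of laws by sequences. Surjectivity up to [same_law]
    suffices, because the sections of [H] are measurable and do not separate such laws. *)
Lemma pprob_projection d (X : measurableType d)
    (H : set (X * pprobability obs R)) : measurable H ->
  univ_measurable R [set x | exists Q, H (x, Q)].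
Proof.
move=> mH.
pose g (xz : X * baire) := (xz.1, pprob_param xz.2).
have mg : measurable_fun setT g.
  apply/measurable_fun_pairP; split; first exact: measurable_fst.
  exact: (measurableT_comp (measurable_unif_image measurable_param_fun) measurable_snd).
have : measurable (g @^-1` H) by rewrite -[X in measurable X]setTI; exact: mg.
rewrite (_ : [set x | _] = [set x | exists z, (g @^-1` H) (x, z)]).
  by move/(@baire_projection R).
apply/seteqP; split=> x /= [].
  move=> Q HQ; have [z Qz] := pprob_param_surj Q; exists z.
  have mS := measurable_xsection x mH.
  have := same_law_measurable mS Qz; rewrite /xsection /= !inE; exact.
by move=> z Hz; exists (pprob_param z).
Qed.

End projection.

(** * Disintegration *)

Section same_law.
Context (R : realType) d (T : measurableType d) (mu nu : probability T R).
Hypothesis munu : same_law mu nu.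

Lemma same_law_sym : same_law nu mu.
Proof. by move=> B mB; rewrite munu. Qed.

Lemma same_law_integral (f : T -> \bar R) D : measurable D ->
  (\int[mu]_(x in D) f x = \int[nu]_(x in D) f x)%E.
Proof. by move=> mD; apply: eq_measure_integral => A mA _; exact: munu. Qed.

Lemma same_law_integrable (f : T -> \bar R) :
  mu.-integrable setT f -> nu.-integrable setT f.
Proof.
move=> /integrableP[mf h]; apply/integrableP; split=> //.
by rewrite -(same_law_integral _ measurableT).
Qed.

Lemma same_law_ae (Q : T -> Prop) :
  {ae mu, forall x, Q x} -> {ae nu, forall x, Q x}.
Proof. by move=> [N [mN N0 sN]]; exists N; split=> //; rewrite -munu. Qed.

End same_law.

Section disintegration.
Context (R : realType) d d' (X : measurableType d) (W : measurableType d').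
Variables (P : probability (X * W)%type R) (mu : probability X R)
  (k : X -> pprobability W R).
Hypothesis mk : measurable_fun setT k.
Hypothesis Pk : forall A B, measurable A -> measurable B ->
  P (A `*` B) = (\int[mu]_(x in A) (k x : probability W R) B)%E.

(** The dummy [unit] factor turns the marginal and the kernel into two kernels that [kcomp] can
    compose, so that its integration formula yields the disintegration. *)
Let pr (ux : unit * X) (v : W) : X * W := (ux.2, v).
Let mpr ux : measurable_fun setT (pr ux).
Proof. exact: measurable_pair1. Qed.
HB.instance Definition _ ux := @isMeasurableFun.Build _ _ _ _ (pr ux) (mpr ux).

Let K (ux : unit * X) : pprobability (X * W)%type R :=
  distribution (k ux.2 : probability W R) (pr ux).

Let mK : measurable_fun setT K.
Proof.
apply: measurable_pprob => U mU.
have h := measurable_fun_xsection_finite_kernel (kprobability mk).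
have := measurableT_comp (h U (mem_set mU)) (@measurable_snd _ _ unit X).
apply: eq_measurable_fun => -[u x] _ /=.
rewrite (_ : xsection U x = pr (u, x) @^-1` U)//.
by apply/seteqP; split=> v; rewrite /xsection /= inE.
Qed.

Let l (u : unit) : pprobability X R := mu.
Let ml : measurable_fun setT l. Proof. exact: measurable_cst. Qed.

Let kl := kprobability ml.
Let kK := kprobability mK.

Let PE E : measurable E -> P E = (kcomp kl kK tt : {measure set _ -> \bar R}) E.
Proof.
pose G : set (set (X * W)) := [set A `*` B | A in measurable & B in measurable].
apply: (measure_unique G (fun=> setT)) => //.
- by rewrite -measurable_prod_measurableType.
- move=> _ _ [A mA [B mB <-]] [C mC [D mD <-]].
  exists (A `&` C); first exact: measurableI.
  by exists (B `&` D); [exact: measurableI|rewrite setXI].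
- by move=> _; exists setT => //; exists setT => //; rewrite setXTT.
- by rewrite bigcup_const//; exists 0%N.
- move=> _ [A mA [B mB <-]].
  transitivity (\int[mu]_(x in A) (k x : probability W R) B)%E; first exact: Pk.
  transitivity (\int[mu]_x (kK (tt, x) (A `*` B)))%E; last by [].
  rewrite integral_mkcond.
  apply: eq_integral => x _; rewrite patchE.
  have -> : kK (tt, x) (A `*` B) = (k x : probability W R) (pr (tt, x) @^-1` (A `*` B)) by [].
  case: ifPn => [xA|xA].
    rewrite (_ : _ @^-1` _ = B)//; apply/seteqP; split=> v //=; first by case.
    by move=> Bv; split=> //; exact: set_mem.
  rewrite (_ : _ @^-1` _ = set0) ?measure0//.
  by apply/seteqP; split=> v //= -[/mem_set]; rewrite (negbTE xA).
- by move=> _; apply: (@le_lt_trans _ _ 1%E); [exact: probability_le1|exact: ltry].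
Qed.

Lemma disint_ge0 (f : X * W -> \bar R) : measurable_fun setT f ->
  (forall z, 0 <= f z)%E ->
  (\int[P]_z f z = \int[mu]_x \int[k x]_v f (x, v))%E.
Proof.
move=> mf f0.
transitivity (\int[(kcomp kl kK tt : {measure set _ -> \bar R})]_z f z)%E.
  by apply: eq_measure_integral => E mE _; exact: PE.
rewrite (integral_kcomp kl kK)//; apply: eq_integral => x _.
by rewrite /kK /kprobability /K ge0_integral_distribution.
Qed.

Lemma measurable_disint (f : X * W -> \bar R) : measurable_fun setT f ->
  (forall z, 0 <= f z)%E ->
  measurable_fun setT (fun x => \int[k x]_v f (x, v))%E.
Proof.
by move=> mf f0; exact: (measurable_fun_integral_finite_kernel _ (kprobability mk)).
Qed.

Lemma disint_ae (Q : X * W -> Prop) : {ae P, forall z, Q z} ->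
  {ae mu, forall x, {ae (k x : probability W R), forall v, Q (x, v)}}.
Proof.
move=> [N [mN N0 sN]].
pose f (z : X * W) : \bar R := (\1_N z)%:E.
have mf : measurable_fun setT f by apply/measurable_EFinP.
have f0 z : (0 <= f z)%E by rewrite lee_fin.
have I0 : (\int[mu]_x \int[k x]_v f (x, v))%E = 0%E.
  by rewrite -disint_ge0// integral_indic// setIT; exact: N0.
have : {ae mu, forall x, setT x -> \int[k x]_v f (x, v) = 0}%E.
  apply/ae_eq_integral_abs => //; first exact: measurable_disint.
  rewrite -[RHS]I0; apply: eq_integral => x _.
  by rewrite gee0_abs// integral_ge0.
apply: filterS => x /(_ I) Nx.
exists (xsection N x); split; first exact: measurable_xsection.
  move: Nx; rewrite (_ : (fun v => f (x, v)) = fun v => (\1_(xsection N x) v)%:E).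
    by rewrite integral_indic//= ?setIT//; exact: measurable_xsection.
  by apply/funext => v; rewrite /f !indicE mem_xsection.
by move=> v /= /sN; rewrite /xsection /= inE.
Qed.

Lemma disint_integrable (f : X * W -> \bar R) : P.-integrable setT f ->
  {ae mu, forall x, (k x : probability W R).-integrable setT (fun v => f (x, v))}.
Proof.
move=> /integrableP[mf fi].
have mf' : measurable_fun setT (fun z => `|f z|)%E by exact: measurableT_comp.
have h := disint_ge0 mf' (fun=> abse_ge0 _).
have : mu.-integrable setT (fun x => \int[k x]_v `|f (x, v)|)%E.
  apply/integrableP; split; first exact: (measurable_disint mf').
  under eq_integral do rewrite gee0_abs ?integral_ge0//.
  by rewrite -h.
move=> /(integrable_ae measurableT); apply: filterS => x /(_ I).
rewrite ge0_fin_numE ?integral_ge0// => xfin.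
by apply/integrableP; split=> //; exact: (measurableT_comp mf (measurable_pair1 x)).
Qed.

Lemma disint_integral (f : X * W -> \bar R) : P.-integrable setT f ->
  mu.-integrable setT (fun x => \int[k x]_v f (x, v))%E /\
  (\int[P]_z f z = \int[mu]_x \int[k x]_v f (x, v))%E.
Proof.
move=> fi.
have ge0i (g : X * W -> \bar R) : P.-integrable setT g -> (forall z, 0 <= g z)%E ->
    mu.-integrable setT (fun x => \int[k x]_v g (x, v))%E.
  move=> /integrableP[mg gi] g0; apply/integrableP; split; first exact: (measurable_disint mg).
  under eq_integral do rewrite gee0_abs ?integral_ge0//.
  by rewrite -disint_ge0//; under eq_integral do rewrite -(gee0_abs (g0 _)).
have mf := measurable_int _ fi.
have h1 := ge0i _ (integrable_funepos measurableT fi) (funepos_ge0 _).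
have h2 := ge0i _ (integrable_funeneg measurableT fi) (funeneg_ge0 _).
have E : (fun x => \int[k x]_v f (x, v))%E =
    ((fun x => \int[k x]_v f^\+ (x, v)) \- (fun x => \int[k x]_v f^\- (x, v)))%E.
  by apply/funext => x; rewrite [LHS]integralE; congr (_ - _)%E;
    apply: eq_integral => v _; rewrite ?funeposE ?funenegE.
split; first by rewrite E; exact: integrableB.
rewrite E integralB// [LHS]integralE (disint_ge0 (measurable_funepos mf))//.
by rewrite (disint_ge0 (measurable_funeneg mf)).
Qed.

End disintegration.

Section arm_law.
Context (R : realType).
Local Notation obs := (obs R).

Lemma arm_setX (a : bool) (B : set R) :
  (arm_set a : set obs) `&` (@outcome R @^-1` B) = [set a] `*` B.
Proof.
by apply/seteqP; split=> -[b y] [] => [[/= -> _]|/= ->] By.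
Qed.

Lemma arm_lawE (Q : probability obs R) a p B : Q (arm_set a) = p%:E -> 0 < p ->
  measurable B -> Q ([set a] `*` B) = (p%:E * arm_law Q a B)%E.
Proof.
move=> Qp p0 mB; rewrite /arm_law /distribution /pushforward /= /mnormalize /= /mrestr.
rewrite setTI Qp eqe gt_eqF //= setIC arm_setX muleC -muleA -EFinM mulVf ?gt_eqF// mule1//.
Qed.

Lemma same_law_arm (Q Q' : probability obs R) a : same_law Q Q' ->
  same_law (arm_law Q a) (arm_law Q' a).
Proof.
move=> QQ B mB; rewrite /arm_law /distribution /pushforward /= /mnormalize /= /mrestr.
have m : measurable (outcome (R := R) @^-1` B).
  by rewrite -[X in measurable X]setTI; exact: measurable_outcome.
have e1 : Q (setT `&` arm_set a) = Q' (setT `&` arm_set a).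
  by rewrite QQ// setTI; exact: measurable_arm_set.
have e2 : Q (@outcome R @^-1` B `&` arm_set a) = Q' (@outcome R @^-1` B `&` arm_set a).
  by rewrite QQ//; apply: measurableI => //; exact: measurable_arm_set.
by rewrite e1; case: ifP => // _; rewrite /mrestr e2.
Qed.

Section decomposition.
Variables (Q : probability obs R) (p : bool -> R).
Hypothesis Qp : forall a, Q (arm_set a) = (p a)%:E.
Hypothesis p_gt0 : forall a, 0 < p a.
Local Notation K := (arm_law Q).

Lemma measurable_arm_section d (T : measurableType d) (g : obs -> T) a :
  measurable_fun setT g -> measurable_fun setT (fun y => g (a, y)).
Proof. by move=> mg; exact: measurableT_comp (measurable_pair1 a). Qed.

Let inj (a : bool) (y : R) : obs := (a, y).
Let minj a : measurable_fun setT (inj a).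
Proof. exact: measurable_pair1. Qed.
HB.instance Definition _ a := @isMeasurableFun.Build _ _ _ _ (inj a) (minj a).

(** Total probability over the arms is stated as an equality of measures, so that integrals split at
    once. *)
Let part (a : bool) : {measure set obs -> \bar R} :=
  mscale (NngNum (ltW (p_gt0 a))) (distribution (K a) (inj a)).

Let QE U : measurable U -> Q U = measure_add (part false) (part true) U.
Proof.
move=> mU; rewrite measure_addE.
have partE a : part a U = Q (U `&` arm_set a).
  have mV : measurable (inj a @^-1` U) by rewrite -[X in measurable X]setTI; exact: minj.
  transitivity ((p a)%:E * K a (inj a @^-1` U))%E; first by [].
  rewrite -(arm_lawE (Qp a))//; congr (Q _).
  apply/seteqP; split=> -[b y]; first by move=> [/= -> Uy]; split.
  by move=> [Uy [/= ba _]]; split=> //=; rewrite /inj -ba.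
rewrite !partE [LHS](measureDI Q mU (measurable_arm_set true)); congr (Q _ + _)%E.
apply/seteqP; split=> -[[] y].
- by move=> [_ /=]; case.
- by move=> [Uy _]; split.
- by move=> [_ [/= ]].
- by move=> [Uy _]; split=> // -[/= ].
Qed.

Lemma obs_integral_ge0 (g : obs -> \bar R) : measurable_fun setT g ->
  (forall v, 0 <= g v)%E ->
  (\int[Q]_v g v = (p false)%:E * \int[K false]_y g (false, y) +
                   (p true)%:E * \int[K true]_y g (true, y))%E.
Proof.
move=> mg g0.
transitivity (\int[measure_add (part false) (part true)]_v g v)%E.
  by apply: eq_measure_integral => U mU _; exact: QE.
rewrite ge0_integral_measure_add//; congr (_ + _)%E.
  rewrite /part ge0_integral_mscale// ge0_integral_distribution//.
by rewrite /part ge0_integral_mscale// ge0_integral_distribution.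
Qed.

Lemma obs_integrable (g : obs -> \bar R) : measurable_fun setT g ->
  (forall a, (K a).-integrable setT (fun y => g (a, y))) ->
  Q.-integrable setT g.
Proof.
move=> mg h; apply/integrableP; split=> //.
rewrite obs_integral_ge0//; last exact: measurableT_comp.
have hb b : ((p b)%:E * \int[K b]_y `|g (b, y)| < +oo)%E.
  apply: lte_mul_pinfty; [by rewrite lee_fin ltW|by []|].
  by have /integrableP[] := h b.
by apply: lte_add_pinfty.
Qed.

Lemma arm_integrable_of (g : obs -> \bar R) a : Q.-integrable setT g ->
  (K a).-integrable setT (fun y => g (a, y)).
Proof.
move=> /integrableP[mg gi]; apply/integrableP; split; first exact: measurable_arm_section.
move: gi; rewrite obs_integral_ge0//; last exact: measurableT_comp.
have h b : (0 <= (p b)%:E * \int[K b]_y `|g (b, y)|)%E.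
  by rewrite mule_ge0 ?lee_fin ?integral_ge0// ltW.
move=> gi.
have : ((p a)%:E * \int[K a]_y `|g (a, y)| < +oo)%E.
  by apply: le_lt_trans gi; case: (a); rewrite ?leeDl ?leeDr.
rewrite !ltey; apply: contra_neq => ->.
by rewrite gt0_muley ?lte_fin.
Qed.

Lemma obs_integral (g : obs -> \bar R) : Q.-integrable setT g ->
  (\int[Q]_v g v = (p false)%:E * \int[K false]_y g (false, y) +
                   (p true)%:E * \int[K true]_y g (true, y))%E.
Proof.
move=> gi; have mg := measurable_int _ gi.
have gp := integrable_funepos measurableT gi.
have gn := integrable_funeneg measurableT gi.
rewrite integralE obs_integral_ge0//; last exact: measurable_funepos.
rewrite obs_integral_ge0//; last exact: measurable_funeneg.
have e a : ((p a)%:E * \int[K a]_y g (a, y) =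
    (p a)%:E * \int[K a]_y g^\+ (a, y) - (p a)%:E * \int[K a]_y g^\- (a, y))%E.
  rewrite -muleBr//; last first.
    rewrite fin_num_adde_defl//.
    by rewrite ?fin_numN integrable_fin_num//; exact: (arm_integrable_of _ gn).
  congr (_ * _)%E; rewrite [LHS]integralE; congr (_ - _)%E;
    by apply: eq_integral => y _; rewrite ?funeposE ?funenegE.
have f a (h : obs -> \bar R) : Q.-integrable setT h ->
    ((p a)%:E * \int[K a]_y h (a, y))%E \is a fin_num.
  by move=> hi; rewrite fin_numM// integrable_fin_num//; exact: (arm_integrable_of _ hi).
rewrite !e fin_num_oppeD ?f// addeACA//.
Qed.

Lemma arm_law_dominates (Q' : probability obs R) a : Q' `<< Q ->
  Q' (arm_set a) = (p a)%:E -> arm_law Q' a `<< K a.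
Proof.
move=> /null_content_dominatesP dom Q'p; apply/null_content_dominatesP => B mB KB.
have : ((p a)%:E * arm_law Q' a B = 0)%E.
  rewrite -(arm_lawE Q'p)//; apply: dom; first exact: measurableX.
  transitivity ((p a)%:E * K a B)%E; first exact: arm_lawE.
  have -> : K a B = 0%E by exact: KB.
  by rewrite mule0.
by move/eqP; rewrite mule_eq0 eqe gt_eqF//= => /eqP.
Qed.

End decomposition.
End arm_law.

(** * Conditional variance of scores that are affine on each arm *)

Section moments.
Context (R : realType).

Lemma varianceE_sqr d (T : measurableType d) (P : probability T R) (h : T -> R) m :
  ('E_P[h] = m%:E)%E -> ('V_P[h] = \int[P]_x ((h x - m) ^+ 2)%:E)%E.
Proof.
move=> hm; rewrite /variance unlock hm /= [in LHS]unlock.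
by apply: eq_integral => x _; rewrite /= expr2.
Qed.

Variables (K : probability R R) (m : R).
Hypothesis Ki : K.-integrable setT (fun y : R => y%:E).
Hypothesis Km : ('E_K[fun y => y] = m%:E)%E.

(** The centre [m0] is kept apart from the mean [m]: after a mean shift the score is still affine
    around the old mean while the law has the new one. *)
Lemma integral_affine (g : R -> R) (c b m0 : R) : measurable_fun setT g ->
  {ae K, forall y, g y = c + b * (y - m0)} ->
  (\int[K]_y (g y)%:E = (c + b * (m - m0))%:E)%E.
Proof.
move=> mg gE.
have i1 : K.-integrable setT (fun=> (c - b * m0)%:E).
  exact: finite_measure_integrable_cst.
have i2 : K.-integrable setT (fun y : R => (b * y)%:E).
  by under eq_fun do rewrite EFinM; exact: integrableZl.
transitivity (\int[K]_y ((c - b * m0)%:E + (b * y)%:E))%E.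
  apply: ae_eq_integral => //.
  - exact/measurable_EFinP.
  - by apply: emeasurable_funD; [exact: measurable_int i1|exact: measurable_int i2].
  - by apply: filterS gE => y -> _; rewrite -EFinD; congr EFin; ring.
rewrite integralD// integral_cst//= probability_setT mule1.
under eq_integral do rewrite EFinM.
rewrite integralZl//; move: Km; rewrite unlock => ->.
by rewrite -EFinM -EFinD; congr EFin; ring.
Qed.

Lemma integral_affine_sqr (g : R -> R) (c b v : R) : measurable_fun setT g ->
  {ae K, forall y, g y = c + b * (y - m)} ->
  ('V_K[fun y => y] = v%:E)%E ->
  (\int[K]_y ((g y) ^+ 2)%:E = (c ^+ 2 + b ^+ 2 * v)%:E)%E.
Proof.
move=> mg gE; rewrite (varianceE_sqr Km) => Kv.
have i1 : K.-integrable setT (fun=> (c ^+ 2 - c * b * m *+ 2)%:E).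
  exact: finite_measure_integrable_cst.
have i2 : K.-integrable setT (fun y : R => (c * b *+ 2 * y)%:E).
  by under eq_fun do rewrite EFinM; exact: integrableZl.
have i3 : K.-integrable setT (fun y : R => ((y - m) ^+ 2)%:E).
  apply/integrableP; split.
    by apply/measurable_EFinP; apply: measurable_funX; exact: measurable_funB.
  by under eq_integral do rewrite gee0_abs ?lee_fin ?sqr_ge0//; rewrite Kv ltry.
have i4 : K.-integrable setT (fun y : R => (b ^+ 2 * (y - m) ^+ 2)%:E).
  by under eq_fun do rewrite EFinM; exact: integrableZl.
transitivity (\int[K]_y ((c ^+ 2 - c * b * m *+ 2)%:E + (c * b *+ 2 * y)%:E +
    (b ^+ 2 * (y - m) ^+ 2)%:E))%E.
  apply: ae_eq_integral => //.
  - by apply/measurable_EFinP; exact: measurable_funX.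
  - by apply: emeasurable_funD; [apply: emeasurable_funD|];
      [exact: measurable_int i1|exact: measurable_int i2|exact: measurable_int i4].
  - by apply: filterS gE => y -> _; rewrite -!EFinD; congr EFin; ring.
rewrite integralD//; last exact: integrableD.
rewrite integralD// integral_cst//= probability_setT mule1.
under [X in (_ + X + _)%E]eq_integral do rewrite EFinM.
under [X in (_ + X)%E]eq_integral do rewrite EFinM.
rewrite !integralZl// Kv; move: Km; rewrite unlock => ->.
by rewrite -!EFinM -!EFinD; congr EFin; ring.
Qed.

End moments.

Lemma measurable_obs (R : realType) d (T : measurableType d) (g : obs R -> T) :
  (forall a, measurable_fun setT (fun y => g (a, y))) -> measurable_fun setT g.
Proof.
move=> mg; rewrite (_ : g = fun w => if w.1 then g (true, w.2) else g (false, w.2)).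
  by apply: measurable_fun_if => //; apply: (@measurable_funS _ _ _ _ setT) => //;
    apply: (measurableT_comp (mg _)).
by apply/funext => -[[] y].
Qed.

Lemma integral_cst_prob (R : realType) d (T : measurableType d)
  (P : probability T R) (c : \bar R) : (\int[P]_x cst c x = c)%E.
Proof. by rewrite integral_cst//= probability_setT mule1. Qed.

Lemma sum_bool (R : nmodType) (S : pred bool) (F : bool -> R) :
  \sum_(a : bool | S a) F a =
  (if S true then F true else 0) + (if S false then F false else 0).
Proof. by rewrite big_mkcond big_bool. Qed.

Section pointwise.
Context (R : realType).
Variables (Q : probability (obs R) R) (p m v : bool -> R).
Hypothesis Qp : forall a, Q (arm_set a) = (p a)%:E.
Hypothesis p_gt0 : forall a, 0 < p a.
Local Notation K := (arm_law Q).
Hypothesis Ki : forall a, arm_integrable Q a.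
Hypothesis Km : forall a, ('E_(K a)[fun y => y] = (m a)%:E)%E.
Hypothesis Kv : forall a, (arm_var Q a = (v a)%:E)%E.

Lemma variance_arms (h : obs R -> R) mu : measurable_fun setT h ->
  ('E_Q[h] = mu%:E)%E ->
  ('V_Q[h] = (p false)%:E * \int[K false]_y ((h (false, y) - mu) ^+ 2)%:E +
             (p true)%:E * \int[K true]_y ((h (true, y) - mu) ^+ 2)%:E)%E.
Proof.
move=> mh hmu; rewrite (varianceE_sqr hmu) (obs_integral_ge0 Qp)//.
- apply/measurable_EFinP; apply: measurable_funX; exact: measurable_funB.
- by move=> w; rewrite lee_fin sqr_ge0.
Qed.

(* The sum over the arms of p a * b a * (m' a - m a) is the derivative of the
   mean of h along the perturbation. *)
Lemma slope_identity (Q' : probability (obs R) R) (h : obs R -> R)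
    (c b m' : bool -> R) mu mu' : measurable_fun setT h ->
  (forall a, {ae K a, forall y, h (a, y) = c a + b a * (y - m a)}) ->
  Q' `<< Q -> (forall a, Q' (arm_set a) = (p a)%:E) ->
  (forall a, arm_integrable Q' a) ->
  (forall a, ('E_(arm_law Q' a)[fun y => y] = (m' a)%:E)%E) ->
  Q.-integrable setT (EFin \o h) -> Q'.-integrable setT (EFin \o h) ->
  (\int[Q]_w (h w)%:E = mu%:E)%E -> (\int[Q']_w (h w)%:E = mu'%:E)%E ->
  p false * b false * (m' false - m false) +
  p true * b true * (m' true - m true) = mu' - mu.
Proof.
move=> mh hE dom Q'p Q'i Q'm hi hi' hmu hmu'.
have mha a : measurable_fun setT (fun y => h (a, y)) by exact: measurable_arm_section.
(* Absolute continuity carries the affine form, with the same coefficients, to the arm laws of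
   [Q']. *)
have hE' a : {ae arm_law Q' a, forall y, h (a, y) = c a + b a * (y - m a)}.
  have d := arm_law_dominates Qp p_gt0 dom (Q'p a).
  by have [N [mN N0 sN]] := hE a; exists N; split=> //; move/null_content_dominatesP: d; apply.
have e1 := obs_integral Qp p_gt0 hi.
have e2 := obs_integral Q'p p_gt0 hi'.
move: e1 e2; rewrite /= hmu hmu'.
rewrite (integral_affine (Ki false) (Km false) (mha false) (hE false)).
rewrite (integral_affine (Ki true) (Km true) (mha true) (hE true)).
rewrite (integral_affine (Q'i false) (Q'm false) (mha false) (hE' false)).
rewrite (integral_affine (Q'i true) (Q'm true) (mha true) (hE' true)).
by rewrite -!EFinM -!EFinD => -[->] [->]; ring.
Qed.

Lemma precision_sum_gt0 (S : bool -> bool) : (exists a, S a) ->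
  (forall a, S a -> 0 < v a) -> 0 < \sum_(a : bool | S a) p a / v a.
Proof.
move=> [a Sa] v0; rewrite (bigD1 a)//= ltr_wpDr ?divr_gt0 ?v0//.
by apply: sumr_ge0 => b /andP[Sb _]; rewrite divr_ge0// ltW// v0.
Qed.

Lemma variance_lower (S : bool -> bool) (h : obs R -> R) (c b : bool -> R) mu :
  measurable_fun setT h ->
  (forall a, {ae K a, forall y, h (a, y) = c a + b a * (y - m a)}) ->
  ('E_Q[h] = mu%:E)%E ->
  (exists a, S a) -> (forall a, S a -> 0 < v a) ->
  \sum_(a : bool | S a) p a * b a = 1 ->
  (((\sum_(a : bool | S a) p a / v a)^-1)%:E <= 'V_Q[h])%E.
Proof.
move=> mh hE hmu S0 v0 sb; rewrite (variance_arms mh hmu).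
have v_ge0 a : 0 <= v a by rewrite -lee_fin -Kv variance_ge0.
have IK a : (\int[K a]_y ((h (a, y) - mu) ^+ 2)%:E = ((c a - mu) ^+ 2 + b a ^+ 2 * v a)%:E)%E.
  apply: (integral_affine_sqr (Ki a) (Km a)); last exact: Kv.
    by apply: measurable_funB => //; exact: measurable_arm_section.
  by apply: filterS (hE a) => y ->; ring.
rewrite !IK -!EFinM -EFinD lee_fin.
have T0 := precision_sum_gt0 S0 v0.
rewrite -(ler_pM2l T0) mulfV ?gt_eqF//.
(* The squared offsets of the intercepts and the whole contribution of arms outside [S] are
   nonnegative and are dropped first; Cauchy-Schwarz is then applied on [S] alone. *)
apply: (@le_trans _ _ ((\sum_(a : bool | S a) p a / v a) *
   (\sum_(a : bool | S a) p a * (b a ^+ 2 * v a)))); last first.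
  apply: ler_wpM2l; first exact: ltW.
  rewrite sum_bool addrC.
  have q a : (if S a then p a * (b a ^+ 2 * v a) else 0) <= p a * ((c a - mu) ^+ 2 + b a ^+ 2 * v a).
    have n0 : 0 <= p a * (b a ^+ 2 * v a).
      by apply: mulr_ge0; [exact: ltW|apply: mulr_ge0; [exact: sqr_ge0|exact: v_ge0]].
    have n1 : 0 <= p a * (c a - mu) ^+ 2.
      by apply: mulr_ge0; [exact: ltW|exact: sqr_ge0].
    by rewrite mulrDr; case: ifP => _; rewrite ?lerDr ?addr_ge0.
  by apply: lerD.
move: sb v0; rewrite !sum_bool.
have [p0 p1] := (p_gt0 false, p_gt0 true).
case St: (S true); case Sf: (S false); rewrite ?addr0 ?add0r => sb v0; last first.
- by move/eqP: sb; rewrite eq_sym oner_eq0.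
- have vt := v0 false Sf.
  have -> : p false / v false * (p false * (b false ^+ 2 * v false)) = (p false * b false) ^+ 2.
    by field; rewrite gt_eqF.
  by rewrite sb expr1n.
- have vt := v0 true St.
  have -> : p true / v true * (p true * (b true ^+ 2 * v true)) = (p true * b true) ^+ 2.
    by field; rewrite gt_eqF.
  by rewrite sb expr1n.
- have vt := v0 true St; have vf := v0 false Sf.
  rewrite -subr_ge0 -(expr1n _ 2) -sb.
  (* Lagrange's identity: with 1 written as the square of the weighted sum of slopes, the defect in
     Cauchy-Schwarz is an explicit square. *)
  rewrite [leRHS](_ : _ = p true * p false * (b true * v true - b false * v false) ^+ 2 / (v true * v false)).
    apply: divr_ge0; last by apply: mulr_ge0; exact: ltW.
    by apply: mulr_ge0; [apply: mulr_ge0; exact: ltW|exact: sqr_ge0].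
  by field; rewrite !gt_eqF.
Qed.

(** On [S] the slope is 1 / (T * v a), which makes slope times variance the same for all arms: the
    equality case of Cauchy-Schwarz. *)
Lemma variance_optimal (S : bool -> bool) (mu : R) :
  (exists a, S a) -> (forall a, S a -> 0 < v a) ->
  let T := \sum_(a : bool | S a) p a / v a in
  let h (w : obs R) := mu + (if S w.1 then p w.1 / v w.1 / T / p w.1 * (w.2 - m w.1) else 0) in
  [/\ measurable_fun setT h, ('E_Q[h] = mu%:E)%E & ('V_Q[h] = (T^-1)%:E)%E].
Proof.
move=> S0 v0 T h.
have T0 : 0 < T := precision_sum_gt0 S0 v0.
pose b a := if S a then p a / v a / T / p a else 0.
have hE a y : h (a, y) = mu + b a * (y - m a).
  by rewrite /h /b /=; case: (S a) => //; rewrite mul0r.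
have mh : measurable_fun setT h.
  apply: measurable_obs => a; under eq_fun do rewrite hE.
  by apply: measurable_funD => //; apply: measurable_funM => //; exact: measurable_funB.
have ha a : {ae K a, forall y, h (a, y) = mu + b a * (y - m a)}.
  by apply: aeW => y; exact: hE.
have mha a : measurable_fun setT (fun y => h (a, y)) by exact: measurable_arm_section.
have p1 : p false + p true = 1.
  have := obs_integral_ge0 Qp p_gt0 (measurable_cst (1%E : \bar R)) (fun=> lee01).
  by rewrite !integral_cst_prob !mule1 -EFinD => -[].
have hi : Q.-integrable setT (EFin \o h).
  apply: (obs_integrable Qp) => //; first exact/measurable_EFinP.
  move=> a; rewrite (_ : (fun _ => _) = (fun y => (mu - b a * m a)%:E + (b a)%:E * y%:E)%E).
    apply: integrableD => //; first exact: finite_measure_integrable_cst.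
    by apply: integrableZl => //; exact: Ki.
  by apply/funext => y; rewrite /= hE -EFinM -EFinD; congr EFin; ring.
have Eh : ('E_Q[h] = mu%:E)%E.
  rewrite unlock (obs_integral Qp p_gt0 hi)/=.
  rewrite (integral_affine (Ki false) (Km false) (mha false) (ha false)).
  rewrite (integral_affine (Ki true) (Km true) (mha true) (ha true)).
  by rewrite !subrr !mulr0 !addr0 -!EFinM -EFinD -mulrDl p1 mul1r.
split=> //; rewrite (variance_arms mh Eh).
have IK a : (\int[K a]_y ((h (a, y) - mu) ^+ 2)%:E = (0 ^+ 2 + b a ^+ 2 * v a)%:E)%E.
  apply: (integral_affine_sqr (Ki a) (Km a)); last exact: Kv.
    by apply: measurable_funB => //; exact: measurable_arm_section.
  by apply: aeW => y; rewrite hE; ring.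
rewrite !IK -!EFinM -EFinD; congr EFin.
have q a : p a * (0 ^+ 2 + b a ^+ 2 * v a) = (if S a then p a / v a else 0) / T ^+ 2.
  rewrite /b; have := v0 a; case: (S a) => [/(_ isT) va|_]; last by rewrite expr0n /= mul0r; ring.
  by field; rewrite !gt_eqF.
rewrite !q -mulrDl (_ : _ + _ = T); first by field; rewrite gt_eqF.
by rewrite /T sum_bool addrC.
Qed.

End pointwise.

(** * Integral inequalities for nonmeasurable functions *)

Section nonmeasurable.
Context (R : realType) d (T : measurableType d) (mu : probability T R).
Import HBNNSimple.

(* No measurability of [f]: the integral of the library is the supremum over
   the simple functions below it. *)
Lemma integral_le_ae (f g : T -> \bar R) : measurable_fun setT g ->
  (forall x, 0 <= g x)%E -> {ae mu, forall x, (f x <= g x)%E} ->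
  (\int[mu]_x f x <= \int[mu]_x g x)%E.
Proof.
move=> mg g0 fg; rewrite integralE.
apply: (@le_trans _ _ (\int[mu]_x f^\+ x)%E).
  by rewrite -[leRHS]sube0; apply: leeB => //; apply: integral_ge0.
rewrite ge0_integralTE//; apply: ge_ereal_sup => _ [h hf <-].
rewrite -integralT_nnsfun; apply: ae_ge0_le_integral => //.
- by move=> x _; rewrite lee_fin.
- exact/measurable_EFinP.
apply: filterS fg => x fx _; apply: le_trans (hf x) _.
by rewrite funeposE ge_max fx g0.
Qed.

(** Both inequalities serve costs along kernels and selections: the cost is Borel only on the graph
    of admissible laws, and a selection is only universally measurable. *)
Lemma integral_ge_ae (f g : T -> \bar R) : measurable_fun setT g ->
  (forall x, 0 <= g x)%E -> {ae mu, forall x, (g x <= f x)%E} ->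
  (\int[mu]_x g x <= \int[mu]_x f x)%E.
Proof.
move=> mg g0 gf.
have fn : (\int[mu]_x f^\- x = 0)%E.
  apply/eqP; rewrite eq_le integral_ge0// andbT.
  have <- : (\int[mu]_(x in setT) cst 0 x = 0)%E by rewrite integral0.
  apply: integral_le_ae => //.
  apply: filterS gf => x gx; rewrite funenegE ge_max lexx andbT oppe_le0.
  exact: le_trans gx.
rewrite [leRHS]integralE fn sube0.
case: gf => N [mN N0 sN].
(* Setting [g] to zero on the exceptional set puts it below the positive part of [f] everywhere, and
   suprema over simple functions below then compare pointwise. *)
pose g' x := (g x * (\1_(~` N) x)%:E)%E.
have g'N x : N x -> g' x = 0%E by move=> Nx; rewrite /g' indicE memNset ?mule0//=; apply.
have g'nN x : ~ N x -> g' x = g x by move=> Nx; rewrite /g' indicE mem_set ?mule1.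
have mg' : measurable_fun setT g'.
  apply: emeasurable_funM => //; apply/measurable_EFinP; apply: measurable_indic.
  exact: measurableC.
have -> : (\int[mu]_x g x = \int[mu]_x g' x)%E.
  apply: ae_eq_integral => //; exists N; split=> // x /= h.
  by apply: contrapT => nNx; apply: h => _; rewrite g'nN.
have g'0 x : (0 <= g' x)%E by have [/g'N->|/g'nN->] := pselect (N x).
rewrite !ge0_integralTE//.
apply: ereal_sup_le => _ [h hg <-] /=.
exists h => // x; apply: le_trans (hg x) _.
rewrite funeposE le_max; have [/g'N->|nNx] := pselect (N x); first by rewrite lexx orbT.
rewrite g'nN//; apply/orP; left; apply: contrapT => gfx.
by apply: nNx; apply: sN.
Qed.

Lemma ae_ex (A : set T) (Q : T -> Prop) : measurable A -> (0 < mu A)%E ->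
  {ae mu, forall x, Q x} -> exists x, A x /\ Q x.
Proof.
move=> mA A0 [N [mN N0 sN]]; apply: contrapT => h.
have : (mu A <= mu N)%E.
  apply: le_measure; rewrite ?inE// => x Ax; apply: sN => Qx; apply: h; by exists x.
by rewrite N0 leNgt A0.
Qed.

Lemma integral_eq0_pos (f : T -> \bar R) : mu.-integrable setT f ->
  {ae mu, forall x, (0 < f x)%E} -> (\int[mu]_x f x)%E != 0%E.
Proof.
move=> fi f0; apply/eqP => h.
have mf := measurable_int _ fi.
have : (\int[mu]_x `|f x| = 0)%E.
  rewrite -[RHS]h; apply: ae_eq_integral => //; first exact: measurableT_comp.
  by apply: filterS f0 => x /ltW fx _; rewrite gee0_abs.
move=> /(ae_eq_integral_abs _ measurableT mf) e.
have T0 : (0 < mu setT)%E by rewrite probability_setT.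
have [x [_ [+ /(_ I)]]] := ae_ex measurableT T0 (filterI f0 e).
by move=> /[swap] /= ->; rewrite ltxx.
Qed.

End nonmeasurable.

(** * Mixtures of two laws *)

Section pmix.
Context (R : realType) d (T : measurableType d).

Definition pmix (t : R) (t01 : 0 <= t <= 1) (mu nu : probability T R) : set T -> \bar R :=
  measure_add (mscale (NngNum (andP t01).1) mu)
    (mscale (NngNum (etrans (subr_ge0 _ _) (andP t01).2)) nu).

Section pmix_prob.
Variables (t : R) (t01 : 0 <= t <= 1) (mu nu : probability T R).

Lemma pmixE U : pmix t01 mu nu U = (t%:E * mu U + (1 - t)%:E * nu U)%E.
Proof. by rewrite /pmix measure_addE. Qed.

HB.instance Definition _ := Measure.on (pmix t01 mu nu).

Let pmix1 : pmix t01 mu nu setT = 1%E.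
Proof. by rewrite pmixE !probability_setT !mule1 -EFinD addrC subrK. Qed.

HB.instance Definition _ := Measure_isProbability.Build _ _ _ (pmix t01 mu nu) pmix1.

Lemma integral_pmix (f : T -> \bar R) : mu.-integrable setT f -> nu.-integrable setT f ->
  (\int[pmix t01 mu nu]_x f x = t%:E * \int[mu]_x f x + (1 - t)%:E * \int[nu]_x f x)%E.
Proof.
move=> fm fn.
have ge0 (g : T -> \bar R) : measurable_fun setT g -> (forall x, 0 <= g x)%E ->
    (\int[pmix t01 mu nu]_x g x = t%:E * \int[mu]_x g x + (1 - t)%:E * \int[nu]_x g x)%E.
  move=> mg g0; rewrite /pmix ge0_integral_measure_add//.
  by rewrite !ge0_integral_mscale.
have mf := measurable_int _ fm.
rewrite integralE ge0//; last exact: measurable_funepos.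
rewrite ge0//; last exact: measurable_funeneg.
rewrite [in RHS]integralE [X in (_ = _ + _ * X)%E]integralE.
have fin (k : {measure set T -> \bar R}) : k.-integrable setT f ->
    (\int[k]_x f^\+ x \is a fin_num)%E /\ (\int[k]_x f^\- x \is a fin_num)%E.
  by move=> ki; rewrite integrable_pos_fin_num// integrable_neg_fin_num.
have [/fineK<- /fineK<-] := fin _ fm; have [/fineK<- /fineK<-] := fin _ fn.
by rewrite -?EFinB -!EFinM -!EFinD; congr EFin; ring.
Qed.

Lemma integrable_pmix (f : T -> \bar R) : mu.-integrable setT f -> nu.-integrable setT f ->
  (pmix t01 mu nu).-integrable setT f.
Proof.
move=> /integrableP[mf fm] /integrableP[_ fn]; apply/integrableP; split=> //.
have mf' : measurable_fun setT (fun x => `|f x|)%E by exact: measurableT_comp.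
rewrite /pmix ge0_integral_measure_add// !ge0_integral_mscale//.
have [/andP[t0 t1]] := t01.
by apply: lte_add_pinfty; apply: lte_mul_pinfty; rewrite ?lee_fin.
Qed.

End pmix_prob.
End pmix.

Lemma measurable_pmix (R : realType) d d' (X : measurableType d) (T : measurableType d')
    (t : X -> R) (t01 : forall x, 0 <= t x <= 1) (mu nu : X -> pprobability T R) :
  measurable_fun setT t -> measurable_fun setT mu -> measurable_fun setT nu ->
  measurable_fun setT (fun x => pmix (t01 x) (mu x) (nu x) : pprobability T R).
Proof.
move=> mt mmu mnu; apply: measurable_pprob => U mU.
rewrite (_ : (fun _ => _) = fun x => ((t x)%:E * (mu x : probability T R) U +
    (1 - t x)%:E * (nu x : probability T R) U)%E); last by apply/funext => x; exact: pmixE.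
apply: emeasurable_funD; apply: emeasurable_funM; try exact: measurable_pprob_eval.
  exact/measurable_EFinP.
by apply/measurable_EFinP; exact: measurable_funB.
Qed.

(** * From identities on pairs of outcomes to an affine function *)

Section affine.
Context (R : realType).
Variables (K : probability R R) (phi : R -> R) (g : R -> R) (c m : R).
Hypothesis mphi : measurable_fun setT phi.
Hypothesis phi_law : forall B, measurable B -> unif R (phi @^-1` B) = K B.
Hypothesis mg : measurable_fun setT g.
Hypothesis Ki : K.-integrable setT (fun y : R => y%:E).
Hypothesis Km : ('E_K[fun y => y] = m%:E)%E.
Hypothesis Kg : (\int[K]_y (g y)%:E = c%:E)%E.

(** The law on the two points [phi u] and [phi v] with barycentre [m] gives [g] the mean [c],
    cleared of its denominator. *)
Let pair_eq u v := phi u <= m < phi v ->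
  (phi v - m) * g (phi u) + (m - phi u) * g (phi v) = c * (phi v - phi u).

Hypothesis pairs1 : {ae unif R, forall u, {ae unif R, forall v, pair_eq u v}}.
Hypothesis pairs2 : {ae unif R, forall v, {ae unif R, forall u, pair_eq u v}}.

Let ae_law (S : R -> Prop) : measurable [set y | S y] ->
  {ae unif R, forall u, S (phi u)} -> {ae K, forall y, S y}.
Proof.
move=> mS [N [mN N0 sN]]; exists (~` [set y | S y]); split=> //; first exact: measurableC.
rewrite -phi_law; last exact: measurableC.
apply/eqP; rewrite -measure_le0 -N0; apply: le_measure; rewrite ?inE//.
by rewrite -[X in measurable X]setTI; apply: mphi => //; exact: measurableC.
Qed.

Let degenerate : {ae K, forall y, y = m} ->
  exists b, {ae K, forall y, g y = c + b * (y - m)}.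
Proof.
move=> ym; exists 0.
have gm : {ae K, forall y, g y = g m} by apply: filterS ym => y ->.
suff <- : g m = c by apply: filterS gm => y ->; rewrite mul0r addr0.
have gm' : {ae K, forall y, g y = g m + 0 * (y - m)}.
  by apply: filterS gm => y ->; rewrite mul0r addr0.
have := integral_affine Ki Km mg gm'.
by rewrite Kg mul0r addr0 => -[].
Qed.

(** A deviation from the mean that keeps one sign has integral zero, hence vanishes almost
    everywhere. *)
Let one_sided (s : R) : s != 0 -> {ae K, forall y, 0 <= s * (y - m)} ->
  {ae K, forall y, y = m}.
Proof.
move=> s0 sy.
have mf : measurable_fun setT (fun y : R => s * (y - m)).
  by apply: measurable_funM => //; exact: measurable_funB.
have e : {ae K, forall y, s * (y - m) = 0 + s * (y - m)}.
  by apply: aeW => y; rewrite add0r.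
have := integral_affine Ki Km mf e; rewrite subrr mulr0 addr0 => i0.
have : (\int[K]_y `|(s * (y - m))%:E| = 0)%E.
  rewrite -[RHS]i0; apply: ae_eq_integral => //.
  - by apply: measurableT_comp => //; exact/measurable_EFinP.
  - exact/measurable_EFinP.
  - by apply: filterS sy => y y0 _; rewrite gee0_abs ?lee_fin.
move=> /ae_eq_integral_abs; rewrite -/(measurable_fun _ _).
move=> /(_ measurableT) h.
have {}h := h (proj2 (measurable_EFinP _ _) mf).
apply: filterS h => y /(_ I) /= [] /eqP.
by rewrite mulf_eq0 (negbTE s0) /= subr_eq0 => /eqP.
Qed.

(** If one side of [m] is null, the law is concentrated at [m] and slope 0 works. Otherwise one
    generic point above [m] fixes the slope and determines [g] at and below [m]; a generic point
    strictly below then transfers the same line to the points above. The first choice uses [pairs2]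
    and the second [pairs1], which is why both orders of quantification are assumed. *)
Lemma affine_of_pairs : exists b, {ae K, forall y, g y = c + b * (y - m)}.
Proof.
have mgt : measurable [set u | m < phi u].
  rewrite -[X in measurable X]setTI -[X in _ `&` X]/(phi @^-1` [set y | m < y]).
  by rewrite -set_itvoy; apply: mphi => //; exact: measurable_itv.
have mlt : measurable [set u | phi u < m].
  rewrite -[X in measurable X]setTI -[X in _ `&` X]/(phi @^-1` [set y | y < m]).
  by rewrite -set_itvNyo; apply: mphi => //; exact: measurable_itv.
have [gt0|] := ltP 0%E (unif R [set u | m < phi u]); last first.
  rewrite measure_le0 => /eqP gt0; apply: degenerate.
  apply: (@one_sided (-1)); first by rewrite oppr_eq0 oner_eq0.
  exists `]m, +oo[%classic; split; first exact: measurable_itv.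
    by rewrite -phi_law; [rewrite set_itvoy|exact: measurable_itv].
  by move=> y /= /negP; rewrite mulN1r oppr_ge0 subr_le0 -ltNge in_itv /= andbT.
have [lt0|] := ltP 0%E (unif R [set u | phi u < m]); last first.
  rewrite measure_le0 => /eqP lt0; apply: degenerate.
  apply: (@one_sided 1); first by rewrite oner_eq0.
  exists `]-oo, m[%classic; split; first exact: measurable_itv.
    by rewrite -phi_law; [rewrite set_itvNyo|exact: measurable_itv].
  by move=> y /= /negP; rewrite mul1r subr_ge0 -ltNge in_itv.
have [v0 [/= v0m hv0]] := ae_ex mgt gt0 pairs2.
pose b := (g (phi v0) - c) / (phi v0 - m).
have bE : g (phi v0) = c + b * (phi v0 - m).
  have vm : phi v0 - m != 0 by rewrite subr_eq0 gt_eqF.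
  by rewrite /b divfK// addrC subrK.
have left_ : {ae unif R, forall u, phi u <= m -> g (phi u) = c + b * (phi u - m)}.
  apply: filterS hv0 => u hu um; have := hu; rewrite /pair_eq um v0m bE => /(_ isT) E.
  have vm : phi v0 - m != 0 by rewrite subr_eq0 gt_eqF.
  apply: (mulfI vm); lra.
have [u0 [/= u0m [hu0 lu0]]] := ae_ex mlt lt0 (filterI pairs1 left_).
have right_ : {ae unif R, forall v, m < phi v -> g (phi v) = c + b * (phi v - m)}.
  apply: filterS hu0 => v hv mv; have := hv; rewrite /pair_eq (ltW u0m) mv => /(_ isT).
  rewrite lu0 ?(ltW u0m)// => E.
  have um : m - phi u0 != 0 by rewrite subr_eq0 gt_eqF.
  apply: (mulfI um); lra.
exists b; apply: ae_law.
  rewrite (_ : [set _ | _] = (fun y => g y - (c + b * (y - m))) @^-1` [set 0]).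
    rewrite -[X in measurable X]setTI.
    suff mm : measurable_fun setT (fun y : R => g y - (c + b * (y - m))) by exact: mm.
    apply: measurable_funB => //; apply: measurable_funD => //.
    by apply: measurable_funM => //; exact: measurable_funB.
  by apply/seteqP; split=> y /= [e]; [rewrite e subrr|exact: subr0_eq].
apply: filterS2 left_ right_ => u l r.
by have [|] := leP (phi u) m; [exact: l|exact: r].
Qed.

End affine.

(** * Robust scores *)

Section model.
Context (R : realType) (dX : measure_display) (X : measurableType dX).
Context (dV : measure_display) (V : measurableType dV).
Variable (M : model R X).
Hypothesis M_wf : well_formed M.
Local Notation W := (obs R).
Local Notation law := (probability (X * W)%type R).
Implicit Types (P : law) (f : score R X V) (w : X -> V).

Lemma kern_measurable P : laws M P -> measurable_fun setT (kern M P).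
Proof. by move=> /M_wf[[]]. Qed.

Lemma kern_rect P : laws M P -> forall A B, measurable A -> measurable B ->
  P (A `*` B) = (\int[marginal P]_(x in A) (kern M P x : probability W R) B)%E.
Proof. by move=> /M_wf[[]]. Qed.

Lemma pscore_gt0 P x a : laws M P -> 0 < arm_coord (pscore M P x) a.
Proof. by move=> /M_wf[_ _ [_ /(_ x)[? ? _] _] _]; case: a. Qed.

Lemma pscore_sum P x : laws M P -> (pscore M P x).1 + (pscore M P x).2 = 1.
Proof. by move=> /M_wf[_ _ [_ /(_ x)[? ? ?] _] _]. Qed.

Lemma marginalE P A : marginal P A = P (A `*` setT).
Proof. by rewrite /marginal /distribution /pushforward setXT. Qed.

Lemma robust_integrable f w P P' : robust_class M f -> laws M P -> laws M P' ->
  measurable_fun setT w ->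
  {ae marginal P, forall x, umean M P' x = umean M P x} \/
  {ae marginal P, forall x, pscore M P' x = pscore M P x} ->
  P.-integrable setT (fun z => (plug M f w P' P z)%:E) /\
  (\int[P]_z (plug M f w P' P z)%:E = \int[marginal P]_x (maxu M P x)%:E)%E.
Proof.
move=> [_ h] lP lP' mw /(h _ _ _ lP lP' mw)[hi e]; split=> //.
by move: e; rewrite /Psi unlock.
Qed.

(** The law supplying the nuisances is kept apart from the law of the data. Taken equal, they give
    the conditional mean of the plugged-in score; taken as a baseline law and its perturbation, they
    give the mean of a score with frozen nuisances. *)
Lemma cond_mean f w P P' : closed_under_restriction M ->
  robust_class M f -> laws M P -> laws M P' -> measurable_fun setT w ->
  {ae marginal P, forall x, umean M P' x = umean M P x} \/
  {ae marginal P, forall x, pscore M P' x = pscore M P x} ->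
  {ae marginal P, forall x,
    (kern M P x : probability W R).-integrable setT
      (fun v => (plug M f w P' P (x, v))%:E) /\
    (\int[kern M P x]_v (plug M f w P' P (x, v))%:E = (maxu M P x)%:E)%E}.
Proof.
move=> restr rf lP lP' mw nuis.
have [fi _] := robust_integrable rf lP lP' mw nuis.
have mk := kern_measurable lP; have Pk := kern_rect lP.
pose h z := (plug M f w P' P z)%:E.
pose G x := (\int[kern M P x]_v h (x, v))%E.
have [Gi _] := disint_integral mk Pk fi.
have ui : (marginal P).-integrable setT (fun x => (maxu M P x)%:E).
  by have [_ _ _] := M_wf lP.
have mG : measurable_fun setT G := measurable_int _ Gi.
have mu_ : measurable_fun setT (fun x => (maxu M P x)%:E) := measurable_int _ ui.
(* On the law restricted to B both sides have the same mean. *)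
pose B_ (s : bool) := [set x | if s then ((maxu M P x)%:E < G x)%E else (G x < (maxu M P x)%:E)%E].
have mB_ s : measurable (B_ s).
    rewrite /B_; case: s; rewrite -[X in measurable X]setTI.
      exact: (measurable_lte measurableT mu_ mG).
    exact: (measurable_lte measurableT mG mu_).
have key s : marginal P (B_ s) = 0%E.
  have mB := mB_ s; set B := B_ s in mB *.
  apply: contrapT => /eqP B0; have {}B0 : (0 < marginal P B)%E by rewrite lt0e B0 measure_ge0.
  have [P'' [lP'' P''E kP'' nP'']] := restr P B lP mB B0.
  have ac (S : X -> Prop) : {ae marginal P, forall x, S x} -> {ae marginal P'', forall x, S x}.
    move=> [N [mN N0 sN]]; exists N; split=> //.
    rewrite marginalE P''E; last exact: measurableX.
    rewrite (_ : P _ = 0%E) ?mul0e//; apply/eqP; rewrite -measure_le0 -N0 marginalE.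
    by apply: le_measure; rewrite ?inE//; [apply: measurableI|]; do ?exact: measurableX; move=> ? [].
  have BB : {ae marginal P'', forall x, B x}.
    exists (~` B); split=> //; first exact: measurableC.
    rewrite marginalE P''E; last by apply: measurableX => //; exact: measurableC.
    rewrite (_ : _ `&` _ = set0) ?measure0 ?mul0e//.
    by apply/seteqP; split=> // -[x v] [[/= nB _] [/= ? _]].
  have nuis'' : {ae marginal P'', forall x, umean M P' x = umean M P'' x} \/
      {ae marginal P'', forall x, pscore M P' x = pscore M P'' x}.
    case: nuis => /ac n; [left|right].
      by apply: filterS2 n nP'' => x -> [-> _ _].
    by apply: filterS2 n nP'' => x -> [_ -> _].
  have [fi'' fE''] := robust_integrable rf lP'' lP' mw nuis''.
  have mk'' := kern_measurable lP''; have Pk'' := kern_rect lP''.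
  have [Gi'' GE''] := disint_integral mk'' Pk'' fi''.
  have ui'' : (marginal P'').-integrable setT (fun x => (maxu M P'' x)%:E).
    by have [_ _ _] := M_wf lP''.
  pose G'' x := (\int[kern M P'' x]_v (plug M f w P' P'' (x, v))%:E)%E.
  (* Conditioning changes neither the kernel nor the structural value on [B], and the nuisances come
     from [P'] on both sides, so the two conditional means coincide. *)
  have GG : {ae marginal P'', forall x, G'' x = G x /\ maxu M P'' x = maxu M P x}.
    apply: filterS2 kP'' nP'' => x kx [ux _ kax]; split; last by rewrite /maxu ux.
    rewrite /G'' /G (same_law_integral kx)//; apply: eq_integral => v _.
    by rewrite /h /plug kax.
  have d0 : (\int[marginal P'']_x (G'' x - (maxu M P'' x)%:E) = 0)%E.
    by rewrite integralB// -GE'' fE'' subee// integrable_fin_num.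
  have d0' : (\int[marginal P'']_x ((maxu M P'' x)%:E - G'' x) = 0)%E.
    by rewrite integralB// -GE'' fE'' subee// integrable_fin_num.
  move: BB {mB B0 P''E}; rewrite /B /B_; case: (s) => BB.
    have pos : {ae marginal P'', forall x, (0 < G'' x - (maxu M P'' x)%:E)%E}.
      by apply: filterS2 BB GG => x xB [e1 e2]; rewrite e1 e2 sube_gt0.
    by have := integral_eq0_pos (integrableB measurableT Gi'' ui'') pos; rewrite d0 eqxx.
  have pos : {ae marginal P'', forall x, (0 < (maxu M P'' x)%:E - G'' x)%E}.
    by apply: filterS2 BB GG => x xB [e1 e2]; rewrite e1 e2 sube_gt0.
  by have := integral_eq0_pos (integrableB measurableT ui'' Gi'') pos; rewrite d0' eqxx.
have nB s : {ae marginal P, forall x, ~ B_ s x}.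
  by exists (B_ s); split=> // x /= /contrapT.
have ki := disint_integrable mk Pk fi.
apply: filterS3 ki (nB true) (nB false) => x ki /= /negP nt /negP nf; split=> //.
by apply/eqP; rewrite eq_le -/(G x) !leNgt nt nf.
Qed.

End model.

(** * Measurable kernels and their supports *)

Section kernels.
Context (R : realType) d (X : measurableType d).

Lemma measurable_kern_integral d' (Y : measurableType d') (k : X -> pprobability Y R)
    (f : X * Y -> \bar R) : measurable_fun setT k -> measurable_fun setT f ->
  measurable_fun setT (fun x => \int[k x]_y f (x, y))%E.
Proof.
move=> mk mf.
rewrite (_ : (fun _ => _) = fun x => (\int[k x]_y f^\+ (x, y) - \int[k x]_y f^\- (x, y))%E).
  apply: emeasurable_funB; apply: (measurable_disint mk) => //.
    exact: measurable_funepos.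
  exact: measurable_funeneg.
apply/funext => x; rewrite [LHS]integralE; congr (_ - _)%E;
  by apply: eq_integral => y _; rewrite ?funeposE ?funenegE.
Qed.

Section arm_kernel.
Variables (k : X -> pprobability (obs R) R) (a : bool).
Hypothesis mk : measurable_fun setT k.

Let kr (x : X) : {measure set (obs R) -> \bar R} := mrestr (k x) (measurable_arm_set a).

Let mkr U : measurable U -> measurable_fun setT (kr ^~ U).
Proof.
move=> mU; apply: (measurable_pprob_eval mk).
by apply: measurableI => //; exact: measurable_arm_set.
Qed.

HB.instance Definition _ := isKernel.Build _ _ _ _ _ kr mkr.

Lemma measurable_arm_law : measurable_fun setT (fun x => arm_law (k x) a : pprobability R R).
Proof.
apply: measurable_pprob => U mU.
have mU' : measurable (@outcome R @^-1` U).
  by rewrite -[X in measurable X]setTI; exact: measurable_outcome.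
exact: (measurable_pprob_eval (measurable_fun_mnormalize kr) mU').
Qed.

Lemma measurable_arm_var : measurable_fun setT (fun x => arm_var (k x) a).
Proof.
pose e (x : X) := fine ('E_(arm_law (k x) a)[fun y => y])%E.
have me : measurable_fun setT e.
  apply: measurableT_comp => //.
  rewrite [X in measurable_fun _ X](_ : _ = fun x => \int[arm_law (k x) a]_y y%:E)%E; last first.
    by apply/funext => x; rewrite unlock.
  have m : measurable_fun setT (fun xy : X * R => (xy.2)%:E).
    by apply/measurable_EFinP; exact: measurable_snd.
  exact: (measurable_kern_integral measurable_arm_law m).
rewrite /arm_var /variance [X in measurable_fun _ X](_ : _ = fun x =>
  \int[arm_law (k x) a]_y ((y - e x) * (y - e x))%:E)%E.
  have m : measurable_fun setT (fun xy : X * R => xy.2 - e xy.1).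
    by apply: measurable_funB; [exact: measurable_snd|exact: measurableT_comp].
  have m2 : measurable_fun setT (fun xy : X * R => ((xy.2 - e xy.1) * (xy.2 - e xy.1))%:E).
    by apply/measurable_EFinP; exact: measurable_funM.
  exact: (measurable_kern_integral measurable_arm_law m2).
by apply/funext => x; rewrite /e unlock [in LHS]unlock [in RHS]unlock.
Qed.

End arm_kernel.

(* Quantiles turn every null-set statement about a measurable family of laws
   into one about measurable selections of their supports. *)
Lemma support_selection (k : X -> pprobability R R) : measurable_fun setT k ->
  exists phi : X * R -> R, [/\ measurable_fun setT phi,
    forall x u, supp (k x) (phi (x, u)) &
    forall x B, measurable B -> unif R [set u | B (phi (x, u))] = (k x : probability R R) B].
Proof.
move=> mk.
pose F (n : nat) (x : X) := (k x : probability R R) `]-oo, rational R n]%classic.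
have mF n : measurable_fun setT (F n).
  by apply: (measurable_pprob_eval mk); exact: measurable_itv.
(* Levels outside the open unit interval are sent to 1/2, so that every selected value, not just
   almost every one, lies in the support; only a null set of levels is affected. *)
pose cl (u : R) := if (0 < u) && (u < 1) then u else 2^-1.
have cl01 u : 0 < cl u < 1.
  by rewrite /cl; case: ifP => // _; apply/andP; split; lra.
have mcl : measurable_fun setT cl.
  by apply: measurable_fun_if => //; apply: measurable_and => //; exact: measurable_fun_ltr.
exists (fun xu => quantile (F ^~ xu.1) (cl xu.2)); split.
- pose c (xu : X * R) := (xu.1, cl xu.2).
  have mc : measurable_fun setT c.
    by apply/measurable_fun_pairP; split; [exact: measurable_fst|exact: (measurableT_comp mcl measurable_snd)].
  exact: (measurableT_comp (measurable_quantile mF) mc).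
- by move=> x u; apply: (@quantile_supp R (k x : probability R R) (cl u) (cl01 u)).
- move=> x B mB; rewrite -(quantile_law (k x) mB).
  have mq : measurable_fun setT (quantile (F ^~ x)).
    exact: (measurableT_comp (measurable_quantile mF) (measurable_pair1 x)).
  have m1 : measurable [set u | B (quantile (F ^~ x) u)].
    by rewrite -[X in measurable X]setTI; exact: mq.
  have m2 : measurable [set u | B (quantile (F ^~ x) (cl u))].
    by rewrite -[X in measurable X]setTI; exact: (measurableT_comp mq mcl).
  rewrite [LHS]unif_setI_oo// [RHS]unif_setI_oo//; congr (unif R _).
  by apply/seteqP; split=> u /= [+ u01]; rewrite /cl; move: (u01); rewrite in_itv /= => ->.
Qed.

(** Tonelli for the indicator of [N]: exceptional covariates depending on the level become
    exceptional levels depending on the covariate. *)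
Lemma ae_swap (mu : probability X R) (N : set (X * R)) : measurable N ->
  (forall u, {ae mu, forall x, ~ N (x, u)}) ->
  {ae mu, forall x, {ae unif R, forall u, ~ N (x, u)}}.
Proof.
move=> mN N0.
pose f (z : X * R) : \bar R := (\1_N z)%:E.
have mf : measurable_fun setT f by apply/measurable_EFinP.
have f0 z : (0 <= f z)%E by rewrite lee_fin.
have I0 : (\int[mu]_x \int[unif R]_u f (x, u) = 0)%E.
  rewrite (fubini_tonelli f)//; apply: integral0_eq => u _.
  transitivity (\int[mu]_x (cst 0 x : \bar R))%E; last by rewrite integral0.
  apply: ae_eq_integral => //; first exact: (measurableT_comp mf (measurable_pair2 u)).
  by apply: filterS (N0 u) => x nN _; rewrite /f indicE memNset.
have : {ae mu, forall x, setT x -> \int[unif R]_u f (x, u) = 0}%E.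
  apply/ae_eq_integral_abs => //.
    exact: (measurable_kern_integral (k := fun=> unif R)).
  by rewrite -[RHS]I0; apply: eq_integral => x _; rewrite gee0_abs// integral_ge0.
apply: filterS => x /(_ I) Nx.
exists (xsection N x); split; first exact: measurable_xsection.
  move: Nx; rewrite (_ : (fun v => f (x, v)) = fun v => (\1_(xsection N x) v)%:E).
    by rewrite integral_indic//= ?setIT//; exact: measurable_xsection.
  by apply/funext => v; rewrite /f !indicE mem_xsection.
by move=> v /= /contrapT; rewrite /xsection /= inE.
Qed.

Lemma measurable_unif_null (N : set (X * R)) : measurable N ->
  measurable [set x | unif R (xsection N x) != 0%E].
Proof.
move=> mN; have m : measurable_fun setT (fun x => unif R (xsection N x)).
  exact: measurable_fun_xsection.
rewrite (_ : [set _ | _] = (fun x => unif R (xsection N x)) @^-1` (~` [set 0%E])).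
  rewrite -[X in measurable X]setTI; apply: m => //.
  by apply: measurableC; exact: emeasurable_set1.
by apply/seteqP; split=> x /= /eqP.
Qed.

End kernels.

Lemma ae_swap2 (R : realType) d (X : measurableType d) (mu : probability X R)
    (N : set (X * R * R)) : measurable N ->
  (forall u v, {ae mu, forall x, ~ N (x, u, v)}) ->
  {ae mu, forall x, {ae unif R, forall u, {ae unif R, forall v, ~ N (x, u, v)}}}.
Proof.
move=> mN N0.
(* The pairs with a non-null set of bad second levels. This set is measurable, so the exchange can
   be made for the second level and then for the first. *)
pose N' := [set xu : X * R | unif R (xsection N xu) != 0%E].
have mN' : measurable N' := measurable_unif_null mN.
have h1 u : {ae mu, forall x, {ae unif R, forall v, ~ N (x, u, v)}}.
  pose q (xv : X * R) := (xv.1, u, xv.2).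
  have mq : measurable_fun setT q.
    apply/measurable_fun_pairP; split; last exact: measurable_snd.
    by apply/measurable_fun_pairP; split; [exact: measurable_fst|exact: measurable_cst].
  apply: (@ae_swap _ _ _ mu (q @^-1` N)); last by move=> v; exact: N0.
  by rewrite -[X in measurable X]setTI; exact: mq.
have h2 u : {ae mu, forall x, ~ N' (x, u)}.
  apply: filterS (h1 u) => x [S [mS S0 sS]]; rewrite /N' /=; apply/negP; rewrite negbK.
  rewrite -measure_le0 -S0; apply: le_measure; rewrite ?inE//; first exact: measurable_xsection.
  by move=> v; rewrite /xsection /= inE => Nv; apply: sS => /=; apply.
apply: filterS (ae_swap mN' h2) => x; apply: filterS => u /negP; rewrite negbK => /eqP e.
exists (xsection N (x, u)); split=> //; first exact: measurable_xsection.
by move=> v /= /contrapT; rewrite /xsection /= inE.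
Qed.

(** * Gluing selections of admissible laws *)

Section gluing.
Context (R : realType) (dX : measure_display) (X : measurableType dX).
Context (dV : measure_display) (V : measurableType dV).
Variable (M : model R X) (L : local_model R X).
Hypothesis M_wf : well_formed M.
Hypothesis std : standing_conditions M L.
Local Notation W := (obs R).
Local Notation law := (probability (X * W)%type R).
Implicit Types (P : law) (f : score R X V) (w : X -> V).

Let cost_below (m : R) : set (X * pprobability W R) :=
  [set z | adm_graph L z /\ cost L z.1 z.2 <= m].

Lemma measurable_cost_below m : measurable (cost_below m).
Proof.
have [[mG [mc _ _ _ _] _] _ _ _] := std.
have := mc mG _ (measurable_itv `]-oo, m]).
by congr measurable; apply/seteqP; split=> z [Gz]; rewrite /= in_itv.
Qed.

Lemma measurable_pair_preimage (k : X -> pprobability W R) (G : set (X * pprobability W R)) :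
  measurable_fun setT k -> measurable G -> measurable [set x | G (x, k x)].
Proof.
move=> mk mG; have m : measurable_fun setT (fun x => (x, k x)).
  by apply/measurable_fun_pairP; split; [exact: measurable_id|exact: mk].
by rewrite -[X in measurable X]setTI; exact: (m measurableT G mG).
Qed.

Lemma selection_cost P (Rs : X -> pprobability W R) (m : R) : laws M P -> 0 <= m ->
  {ae marginal P, forall x, cost L x (Rs x) <= m + cost L x (kern M P x)} ->
  (\int[marginal P]_x (cost L x (Rs x))%:E < +oo)%E.
Proof.
move=> lP m0 le.
have [[mG [mc _ _ _ _] _] _ [c1 cP _] _] := std.
have [admP costP] := cP _ lP.
have mk := kern_measurable M_wf lP.
pose A := [set x | adm_graph L (x, kern M P x)].
have mA : measurable A by exact: measurable_pair_preimage.
pose c x := cost L x (kern M P x).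
have mcA : measurable_fun A c.
  pose q x := (x, kern M P x).
  have mq : measurable_fun setT q by apply/measurable_fun_pairP; split; [exact: measurable_id|exact: mk].
  apply: (@measurable_comp _ _ _ _ _ _ (adm_graph L) (fun z => cost L z.1 z.2) A q) => //.
    by move=> _ [x Ax <-].
  exact: measurable_funS mq.
(* The baseline cost extended by zero off the measurable set of admissible points, which gives a
   measurable majorant up to a null set. *)
pose g := (EFin \o c) \_ A.
have mg : measurable_fun setT g.
  apply/(measurable_restrictT _ mA).1; exact/measurable_EFinP.
have c_ge0 x : A x -> 0 <= c x by move=> Ax; have [/(le_trans ler01)] := c1 _ _ Ax.
have g0 x : (0 <= g x)%E.
  by rewrite /g patchE; case: ifPn => // /set_mem /c_ge0; rewrite lee_fin.
have Ig : (\int[marginal P]_x g x < +oo)%E.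
  apply: le_lt_trans costP; apply: integral_ge_ae => //.
  by apply: filterS admP => x Ax; rewrite /g patchE mem_set.
have mgm : measurable_fun setT (fun x => m%:E + g x)%E by exact: emeasurable_funD.
apply: (@le_lt_trans _ _ (\int[marginal P]_x (m%:E + g x))%E).
  apply: integral_le_ae => //; first by move=> x; rewrite adde_ge0 ?lee_fin.
  by apply: filterS2 le admP => x lx Ax; rewrite /g patchE mem_set//= -EFinD lee_fin.
rewrite ge0_integralD//.
by rewrite [X in (X + _)%E](integral_cst_prob _ m%:E) lte_add_pinfty ?ltry.
Qed.

Lemma same_law_marginal_ae P P' (S : X -> Prop) : same_law (marginal P') (marginal P) ->
  {ae marginal P', forall x, S x} -> {ae marginal P, forall x, S x}.
Proof. by move=> h; apply: (same_law_ae h). Qed.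

(** Where its cost is at most n the perturbation replaces the baseline kernel. The glued law has the
    nuisances of [P], so its own conditional mean identity concerns the same score, integrated
    against [pert]. As costs are finite, the truncation sets exhaust [D] up to a null set. *)
Lemma x1_mean P (a : bool) (pert : X -> pprobability W R) (D : set X) f w :
  X1 M L P -> laws M P -> measurable_fun setT pert -> measurable D ->
  {ae marginal P, forall x, D x -> arm_perturbation M P a x (pert x)} ->
  robust_class M f -> measurable_fun setT w ->
  {ae marginal P, forall x, D x ->
    (\int[pert x]_v (plug M f w P P (x, v))%:E = (maxu M P x)%:E)%E}.
Proof.
move=> x1 lP mpert mD pertP rf mw.
have [_ restr [c1 cP _] _] := std.
have [admP _] := cP _ lP.
have [_ pertadm glueP] := x1 a.
have mk := kern_measurable M_wf lP.
pose B (n : nat) := D `&` [set x | cost_below n%:R (x, pert x)].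
have mB n : measurable (B n).
  apply: measurableI => //; apply: measurable_pair_preimage => //.
  exact: measurable_cost_below.
pose Rs n x := if x \in B n then pert x else kern M P x.
have mRs n : measurable_fun setT (Rs n).
  apply: measurable_pprob => U mU.
  rewrite (_ : (fun _ => _) = fun x => if x \in B n then (pert x : probability W R) U
     else (kern M P x : probability W R) U); last first.
    by apply/funext => x; rewrite /Rs; case: ifP.
  apply: measurable_fun_ifT; [|exact: measurable_pprob_eval..].
  apply: (measurable_fun_bool true); rewrite setTI (_ : _ @^-1` _ = B n)//.
  by apply/seteqP; split=> x /=; [exact: set_mem|exact: mem_set].
have mean n : {ae marginal P, forall x, B n x ->
    (\int[pert x]_v (plug M f w P P (x, v))%:E = (maxu M P x)%:E)%E}.
  have sel : selection L P (fun x => arm_perturbation M P a x `|`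
      [set Q | same_law Q (kern M P x)]) (Rs n).
    split.
    - move=> C mC mu; exists (Rs n @^-1` C), (Rs n @^-1` C).
      have mRC : measurable (Rs n @^-1` C) by rewrite -[X in measurable X]setTI; exact: mRs.
      by split=> //; rewrite setDv measure0.
    - apply: filterS pertP => x px; rewrite /Rs; case: ifPn => [/set_mem[Dx _]|_].
        by left; exact: px.
      by right.
    - apply: (@selection_cost P (Rs n) n%:R) => //; apply: filterS admP => x Ax.
      have [k1 _ _] := c1 _ _ Ax.
      rewrite /Rs; case: ifPn => [/set_mem[_ [_ /= h]]|_]; last by rewrite lerDr.
      by rewrite (le_trans h)// lerDl (le_trans ler01).
  have [P' [[lP' mPP' kP'] nP']] := glueP _ sel.
  have cm := cond_mean M_wf restr rf lP' lP' mw (or_introl (aeW _ (fun x => erefl))).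
  apply: filterS3 (same_law_marginal_ae mPP' cm) kP' nP' => x [_ cx] kx [ux px kax] Bx.
  move: cx; rewrite (same_law_integral kx)// /Rs mem_set// /maxu ux => <-.
  by apply: eq_integral => v _; rewrite /plug /= ux px kax.
have : {ae marginal P, forall x, forall n, B n x ->
    (\int[pert x]_v (plug M f w P P (x, v))%:E = (maxu M P x)%:E)%E}.
  exact/ae_foralln.
apply: filterS3 pertP pertadm => x px pax h Dx.
apply: (h (Num.truncn (cost L x (pert x))).+1); split=> //; split=> /=.
  by apply: pax; exact: px.
by rewrite ltW// truncnS_gt.
Qed.

End gluing.

(** * Two-point perturbations of an arm law *)

(** On nonnegative reals the power -1 is the inverse, so squaring first covers both signs; at 0 both
    sides vanish. *)
Lemma measurable_invr (R : realType) : measurable_fun setT (@GRing.inv R).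
Proof.
rewrite (_ : @GRing.inv R = fun r => r * (r ^+ 2) `^ (-1)).
  apply: measurable_funM => //.
  apply: (measurableT_comp (f := fun r : R => r `^ (-1))); first exact: measurable_powR.
  exact: measurable_funX.
apply/funext => r; rewrite powR_inv1 ?sqr_ge0//.
have [->|r0] := eqVneq r 0; first by rewrite invr0 mul0r.
by field.
Qed.

(** Makes the mixing weight legitimate at every covariate, so that the perturbation is a total
    measurable kernel; it changes nothing where the mean lies between the two points. *)
Definition clamp01 (R : realType) (r : R) : R := Num.max 0 (Num.min 1 r).

Lemma clamp01P (R : realType) (r : R) : 0 <= clamp01 r <= 1.
Proof. by rewrite /clamp01 le_max lexx ge_max ler01 ge_min lexx. Qed.

Lemma clamp01_id (R : realType) (r : R) : 0 <= r <= 1 -> clamp01 r = r.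
Proof. by move=> /andP[r0 r1]; rewrite /clamp01 min_r// max_r. Qed.

Lemma measurable_clamp01 (R : realType) : measurable_fun setT (@clamp01 R).
Proof. by apply: measurable_maxr => //; exact: measurable_minr. Qed.

Lemma half01 (R : realType) : 0 <= (2^-1 : R) <= 1.
Proof. by apply/andP; split; lra. Qed.

Lemma integral_dirac_prob (R : realType) d (T : measurableType d) (x : T) (f : T -> \bar R) :
  measurable_fun setT f -> (\int[(\d_x : probability T R)]_y f y = f x)%E.
Proof. by move=> mf; rewrite integral_dirac// diracT mul1e. Qed.

Lemma integrable_dirac (R : realType) d (T : measurableType d) (x : T) (f : T -> R) :
  measurable_fun setT f -> (\d_x : probability T R).-integrable setT (EFin \o f).
Proof.
move=> mf; have mf' : measurable_fun setT (EFin \o f) by exact/measurable_EFinP.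
apply/integrableP; split=> //; rewrite integral_dirac_prob ?ltry//.
exact: measurableT_comp.
Qed.

Section arm_replacement.
Context (R : realType) (dX : measure_display) (X : measurableType dX).
Variables (k : X -> pprobability (obs R) R) (pi u : X -> R) (a : bool) (y1 y2 : X -> R).
Hypothesis mk : measurable_fun setT k.
Hypothesis mpi : measurable_fun setT pi.
Hypothesis pi01 : forall x, 0 <= pi x <= 1.
Hypothesis mu_ : measurable_fun setT u.
Hypothesis my1 : measurable_fun setT y1.
Hypothesis my2 : measurable_fun setT y2.

(** The weight of [y1 x] solves the barycentre equation with mean [u x]. *)
Definition two_point_law x : probability R R :=
  pmix (clamp01P ((y2 x - u x) / (y2 x - y1 x))) (dirac (y1 x)) (dirac (y2 x)).

Let inj (b : bool) (y : R) : obs R := (b, y).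
Let minj b : measurable_fun setT (inj b).
Proof. exact: measurable_pair1. Qed.
HB.instance Definition _ b := @isMeasurableFun.Build _ _ _ _ (inj b) (minj b).

Definition other_arm x : pprobability (obs R) R :=
  distribution (arm_law (k x) (~~ a)) (inj (~~ a)).

Definition arm_point (b : bool) (y : X -> R) (x : X) : pprobability (obs R) R :=
  dirac (b, y x).

Definition two_point_obs x : pprobability (obs R) R :=
  pmix (clamp01P ((y2 x - u x) / (y2 x - y1 x))) (arm_point a y1 x) (arm_point a y2 x).

Definition replaced x : pprobability (obs R) R :=
  pmix (pi01 x) (two_point_obs x) (other_arm x).

(** Here epsilon is 1/2. Since [replaced] keeps the other arm and, with [pi] the propensity, both
    arm probabilities, mixing whole laws amounts to mixing the law of arm [a] alone. *)
Definition arm_replaced x : pprobability (obs R) R :=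
  pmix (half01 R) (k x) (replaced x).

Let measurable_point b y : measurable_fun setT y -> measurable_fun setT (arm_point b y).
Proof.
move=> my; apply: measurable_pprob => U mU.
have mb : measurable_fun setT (fun x => (b, y x) : obs R).
  by exact: (measurableT_comp (minj b) my).
exact: (measurable_kernel (kdirac mb)).
Qed.

Lemma measurable_arm_replaced : measurable_fun setT arm_replaced.
Proof.
have mth : measurable_fun setT (fun x => clamp01 ((y2 x - u x) / (y2 x - y1 x))).
  apply: (measurableT_comp (@measurable_clamp01 R)).
  apply: measurable_funM; first exact: measurable_funB.
  by apply: (measurableT_comp (@measurable_invr R)); exact: measurable_funB.
apply: measurable_pmix => //.
apply: measurable_pmix => //.
  by apply: measurable_pmix => //; exact: measurable_point.
apply: measurable_pprob => U mU.
have mV : measurable (inj (~~ a) @^-1` U) by rewrite -[X in measurable X]setTI; exact: minj.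
exact: (measurable_pprob_eval (measurable_arm_law (~~ a) mk) mV).
Qed.

Section at_x.
Variables (x : X) (p : bool -> R).
Hypothesis kp : forall b, (k x : probability (obs R) R) (arm_set b) = (p b)%:E.
Hypothesis p_gt0 : forall b, 0 < p b.
Hypothesis pa : pi x = p a.
Hypothesis yx : y1 x <= u x < y2 x.

Let th := (y2 x - u x) / (y2 x - y1 x).

Let y12 : 0 < y2 x - y1 x.
Proof. by move: yx => /andP[h1 h2]; rewrite subr_gt0 (le_lt_trans h1). Qed.

Let th01 : 0 <= th <= 1.
Proof.
move: (yx) => /andP[h1 h2]; rewrite /th; apply/andP; split.
  by rewrite divr_ge0 ?subr_ge0 ?(ltW h2)// -subr_ge0 ltW.
by rewrite ler_pdivrMr// mul1r lerD2l lerN2.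
Qed.

Let psum : p (~~ a) = 1 - p a.
Proof.
have := obs_integral_ge0 kp p_gt0 (measurable_cst (1%E : \bar R)) (fun=> lee01).
rewrite !integral_cst_prob !mule1 -EFinD => -[->].
by case: (a) => /=; ring.
Qed.

Lemma two_point_mean : ('E_(two_point_law x)[fun y => y] = (u x)%:E)%E.
Proof.
rewrite unlock /two_point_law integral_pmix.
- rewrite !integral_dirac_prob; [|exact/measurable_EFinP..].
  rewrite clamp01_id// -!EFinM -EFinD; congr EFin; rewrite -/th /th.
  by field; rewrite gt_eqF.
- by apply: integrable_dirac; exact: measurable_id.
- by apply: integrable_dirac; exact: measurable_id.
Qed.

Let fin_prob d (T : measurableType d) (mu : probability T R) B : measurable B ->
  exists r : R, mu B = r%:E.
Proof. by move=> mB; exists (fine (mu B)); rewrite fineK// fin_num_measure. Qed.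

Let arm_pointE b y c B : (arm_point b y x : probability (obs R) R) ([set c] `*` B) =
  (if b == c then (\d_(y x) : probability R R) B else 0)%E.
Proof.
rewrite /arm_point /= !diracE; case: eqVneq => [->|bc].
  rewrite (_ : ((c, y x) \in [set c] `*` B) = (y x \in B))//.
  by apply/idP/idP; rewrite !inE; [move=> [_ By]|move=> By; split].
by rewrite memNset// => -[/= e _]; rewrite e eqxx in bc.
Qed.

Let other_armE c B : (other_arm x : probability (obs R) R) ([set c] `*` B) =
  (if ~~ a == c then arm_law (k x) (~~ a) B else 0)%E.
Proof.
transitivity (arm_law (k x) (~~ a) (inj (~~ a) @^-1` ([set c] `*` B))); first by [].
case: eqVneq => [<-|bc].
  rewrite (_ : _ @^-1` _ = B)//; apply/seteqP; split=> y /=; first by case.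
  by move=> ?; split.
rewrite (_ : _ @^-1` _ = set0) ?measure0//; apply/seteqP; split=> // y [/= e _].
by rewrite e eqxx in bc.
Qed.

Lemma arm_replaced_arm B : measurable B ->
  (arm_replaced x : probability (obs R) R) ([set a] `*` B) =
  ((pi x)%:E * ((1 - 2^-1)%:E * arm_law (k x) a B + (2^-1)%:E * two_point_law x B))%E.
Proof.
move=> mB; rewrite [LHS]pmixE [X in (_ + _ * X)%E]pmixE [X in (_ + _ * (_ * X + _))%E]pmixE.
rewrite [X in (_ = _ * (_ + _ * X))%E]pmixE.
rewrite (arm_lawE (kp a))// pa !arm_pointE other_armE eqxx.
rewrite (_ : (~~ a == a) = false); last by case: (a).
have [r1 ->] := fin_prob (arm_law (k x) a) mB.
have [r2 ->] := fin_prob (dirac (y1 x)) mB.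
have [r3 ->] := fin_prob (dirac (y2 x)) mB.
by rewrite mule0 adde0 -?(EFinM, EFinD); congr EFin; field.
Qed.

Lemma arm_replaced_other B : measurable B ->
  (arm_replaced x : probability (obs R) R) ([set ~~ a] `*` B) =
  (k x : probability (obs R) R) ([set ~~ a] `*` B).
Proof.
move=> mB; rewrite [LHS]pmixE [X in (_ + _ * X)%E]pmixE [X in (_ + _ * (_ * X + _))%E]pmixE.
rewrite (arm_lawE (kp (~~ a)))// pa !arm_pointE other_armE eqxx.
rewrite (_ : (a == ~~ a) = false); last by case: (a).
have [r1 ->] := fin_prob (arm_law (k x) (~~ a)) mB.
by rewrite !mule0 adde0 -?(EFinM, EFinD) psum; congr EFin; field.
Qed.

(** A mixture and one of its components have the same mean, hence so does the other component. The
    contributions of the unchanged arm cancel, which leaves the two-point mean equal to [c]. *)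
Lemma arm_replaced_integral (h : obs R -> R) (c mu : R) :
  (k x : probability (obs R) R).-integrable setT (EFin \o h) ->
  (\int[k x]_v (h v)%:E = mu%:E)%E ->
  (\int[arm_law (k x) a]_y (h (a, y))%:E = c%:E)%E ->
  (\int[arm_replaced x]_v (h v)%:E = mu%:E)%E ->
  (y2 x - u x) * h (a, y1 x) + (u x - y1 x) * h (a, y2 x) = c * (y2 x - y1 x).
Proof.
move=> hi hmu hc hmu'.
have mh : measurable_fun setT h by apply/measurable_EFinP; exact: measurable_int hi.
have mho : measurable_fun setT (EFin \o h) by exact/measurable_EFinP.
have Ki b : (arm_law (k x) b).-integrable setT (fun y => (h (b, y))%:E).
  exact: (arm_integrable_of kp p_gt0 _ hi).
have oi : (other_arm x : probability (obs R) R).-integrable setT (EFin \o h).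
  exact: (integrable_pushforward _ _ (Ki (~~ a))).
have oE : (\int[other_arm x]_v (h v)%:E = \int[arm_law (k x) (~~ a)]_y (h (~~ a, y))%:E)%E.
  apply: (@integral_distribution _ _ _ _ _ (arm_law (k x) (~~ a)) (inj (~~ a) : {RV (arm_law (k x) (~~ a)) >-> obs R}) (EFin \o h) mho (Ki (~~ a))).
have [c' c'E] : exists c', (\int[arm_law (k x) (~~ a)]_y (h (~~ a, y))%:E = c'%:E)%E.
  by exists (fine (\int[arm_law (k x) (~~ a)]_y (h (~~ a, y))%:E)%E); rewrite fineK// integrable_fin_num//; exact: Ki.
have i1 := integrable_dirac (a, y1 x) mh.
have i2 := integrable_dirac (a, y2 x) mh.
have i12 := integrable_pmix (clamp01P ((y2 x - u x) / (y2 x - y1 x))) i1 i2.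
have irep := integrable_pmix (pi01 x) i12 oi.
move: hmu'; rewrite [LHS](integral_pmix (half01 R) hi irep).
rewrite [X in (_ + _ * X)%E](integral_pmix (pi01 x) i12 oi).
rewrite [X in (_ + _ * (_ * X + _))%E](integral_pmix _ i1 i2).
have d1 : (\int[arm_point a y1 x]_v (h v)%:E = (h (a, y1 x))%:E)%E.
  exact: (integral_dirac_prob (a, y1 x) mho).
have d2 : (\int[arm_point a y2 x]_v (h v)%:E = (h (a, y2 x))%:E)%E.
  exact: (integral_dirac_prob (a, y2 x) mho).
rewrite hmu oE c'E d1 d2 pa clamp01_id//.
pose I b := (\int[arm_law (k x) b]_y (h (b, y))%:E)%E.
have e : mu%:E = ((p a)%:E * I a + (p (~~ a))%:E * I (~~ a))%E.
  have : mu%:E = ((p false)%:E * I false + (p true)%:E * I true)%E.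
    by rewrite -hmu; exact: (obs_integral kp p_gt0 hi).
  by move=> ->; case: (a) => //; rewrite addeC.
have {e} -> : mu = p a * c + (1 - p a) * c'.
  by move: e; rewrite /I hc c'E psum -!EFinM -!EFinD => -[].
rewrite -?(EFinM, EFinD) -/th => -[E].
have pa0 : p a != 0 by rewrite gt_eqF.
have {E} E : th * h (a, y1 x) + (1 - th) * h (a, y2 x) = c by apply: (mulfI pa0); lra.
have yy : y2 x - y1 x != 0 by rewrite gt_eqF.
by rewrite -E /th; field.
Qed.

End at_x.
End arm_replacement.

Lemma measurable_arm_coord (R : realType) a :
  measurable_fun setT (fun v : R * R => arm_coord v a).
Proof. by case: a; [exact: measurable_snd|exact: measurable_fst]. Qed.

(** * Robust scores are affine on each arm *)

Section affine.
Context (R : realType) (dX : measure_display) (X : measurableType dX).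
Context (dV : measure_display) (V : measurableType dV).
Variable (M : model R X) (L : local_model R X).
Hypothesis M_wf : well_formed M.
Hypothesis std : standing_conditions M L.
Local Notation W := (obs R).
Local Notation law := (probability (X * W)%type R).
Implicit Types (P : law) (f : score R X V) (w : X -> V).

Lemma well_formed_arms P : laws M P -> {ae marginal P, forall x,
  [/\ forall a, (kern M P x : probability W R) (arm_set a) = (arm_coord (pscore M P x) a)%:E,
      forall a, arm_integrable (kern M P x) a &
      forall a, ('E_(arm_law (kern M P x) a)[fun y => y] = (arm_coord (umean M P x) a)%:E)%E]}.
Proof.
move=> /M_wf[_ [_ h1] [_ _ h2] _]; apply: filterS2 h1 h2 => x h1 h2; split=> // a.
  by have [] := h1 a.
have [i ->] := h1 a; rewrite /arm_mean fineK// unlock.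
exact: integrable_fin_num.
Qed.

Lemma measurable_umean P a : laws M P ->
  measurable_fun setT (fun x => arm_coord (umean M P x) a).
Proof. by move=> /M_wf[_ [mu_ _] _ _]; exact: (measurableT_comp (measurable_arm_coord a) mu_). Qed.

Lemma measurable_pscore P a : laws M P ->
  measurable_fun setT (fun x => arm_coord (pscore M P x) a).
Proof. by move=> /M_wf[_ _ [mp _ _] _]; exact: (measurableT_comp (measurable_arm_coord a) mp). Qed.

Lemma pscore01 P a x : laws M P -> 0 <= arm_coord (pscore M P x) a <= 1.
Proof.
move=> lP; have [h1 h2] := (pscore_gt0 M_wf x false lP, pscore_gt0 M_wf x true lP).
have := pscore_sum M_wf x lP; move: h1 h2 => /=.
by case: a => /= *; apply/andP; split; lra.
Qed.

Lemma measurable_plug P f w : robust_class M f -> laws M P -> measurable_fun setT w ->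
  measurable_fun setT (plug M f w P P).
Proof.
move=> rf lP mw; have [fi _] := robust_integrable rf lP lP mw (or_introl (aeW _ (fun x => erefl))).
by apply/measurable_EFinP; exact: measurable_int fi.
Qed.

Lemma x1_pair P (a : bool) (y1 y2 : X -> R) f w : X1 M L P -> laws M P ->
  measurable_fun setT y1 -> measurable_fun setT y2 ->
  (forall x, supp (arm_law (kern M P x) a) (y1 x)) ->
  (forall x, supp (arm_law (kern M P x) a) (y2 x)) ->
  robust_class M f -> measurable_fun setT w ->
  let h x v := plug M f w P P (x, v) in
  let u x := arm_coord (umean M P x) a in
  {ae marginal P, forall x, y1 x <= u x < y2 x ->
    (y2 x - u x) * h x (a, y1 x) + (u x - y1 x) * h x (a, y2 x) =
    fine (\int[arm_law (kern M P x) a]_y (h x (a, y))%:E) * (y2 x - y1 x)}.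
Proof.
move=> x1 lP my1 my2 s1 s2 rf mw h u.
have mk := kern_measurable M_wf lP.
have mu_ := measurable_umean a lP.
pose pi01 x := pscore01 a x lP.
pose pert := arm_replaced (kern M P) u a y1 y2 pi01.
have mpert : measurable_fun setT pert.
  by apply: measurable_arm_replaced => //; exact: measurable_pscore.
pose D := [set x | y1 x <= u x < y2 x].
have mD : measurable D.
  rewrite (_ : D = (fun x => (y1 x <= u x) && (u x < y2 x)) @^-1` [set true]); last first.
    by apply/seteqP; split.
  rewrite -[X in measurable X]setTI.
  have m : measurable_fun setT (fun x => (y1 x <= u x) && (u x < y2 x)).
    by apply: measurable_and; [exact: measurable_fun_ler|exact: measurable_fun_ltr].
  exact: m.
have arms := well_formed_arms lP.
have pertP : {ae marginal P, forall x, D x -> arm_perturbation M P a x (pert x)}.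
  apply: filterS arms => x [kp _ _] Dx.
  have pg b : 0 < arm_coord (pscore M P x) b by exact: pscore_gt0.
  exists 2^-1, (two_point_law u y1 y2 x), [set y1 x; y2 x]; split.
  - by apply/andP; split; lra.
  - split; first exact: finite_set2.
      by move=> y [->|->].
    rewrite [LHS]pmixE /= !diracE !mem_set; [|by right|by left].
    by rewrite !mule1 -EFinD addrC subrK.
  - exact: two_point_mean.
  - by move=> B mB; exact: (arm_replaced_arm u y1 y2 pi01 kp pg erefl).
  - by move=> B mB; exact: (arm_replaced_other u y1 y2 pi01 kp pg erefl).
have m1 := x1_mean M_wf std x1 lP mpert mD pertP rf mw.
have [_ restr _ _] := std.
have m2 := cond_mean M_wf restr rf lP lP mw (or_introl (aeW _ (fun x => erefl))).
apply: filterS3 arms m1 m2 => x [kp _ _] m1 [hi m2] Dx.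
have pg b : 0 < arm_coord (pscore M P x) b by exact: pscore_gt0.
have ci : (\int[arm_law (kern M P x) a]_y (h x (a, y))%:E =
    (fine (\int[arm_law (kern M P x) a]_y (h x (a, y))%:E))%:E)%E.
  rewrite fineK// integrable_fin_num//; exact: (arm_integrable_of kp pg a hi).
exact: (arm_replaced_integral (pi01 := pi01) kp pg erefl Dx hi m2 ci (m1 Dx)).
Qed.

(** For fixed levels, [x1_pair] applies to the two measurable families of quantiles. The set of
    failing triples is measurable, so [ae_swap2] produces one null set of covariates off which
    almost all pairs of levels satisfy the identity. *)
Lemma x1_affine P (a : bool) f w : X1 M L P -> laws M P ->
  robust_class M f -> measurable_fun setT w ->
  let h x v := plug M f w P P (x, v) in
  let u x := arm_coord (umean M P x) a in
  {ae marginal P, forall x, exists b, {ae arm_law (kern M P x) a, forall y,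
    h x (a, y) = fine (\int[arm_law (kern M P x) a]_y (h x (a, y))%:E) + b * (y - u x)}}.
Proof.
move=> x1 lP rf mw h u.
have mk := kern_measurable M_wf lP.
have mK := measurable_arm_law a mk.
have mu_ := measurable_umean a lP.
have mh := measurable_plug rf lP mw.
have [phi [mphi sphi lphi]] := support_selection mK.
pose c x := fine (\int[arm_law (kern M P x) a]_y (h x (a, y))%:E).
have mc : measurable_fun setT c.
  apply: measurableT_comp => //.
  pose q (xy : X * R) : X * W := (xy.1, (a, xy.2)).
  have mq : measurable_fun setT q.
    apply/measurable_fun_pairP; split; first exact: measurable_fst.
    exact: (measurableT_comp (measurable_pair1 a) measurable_snd).
  have mhq : measurable_fun setT (fun xy => (plug M f w P P (q xy))%:E).
    by apply/measurable_EFinP; exact: measurableT_comp.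
  exact: (measurable_kern_integral mK mhq).
pose bad (x : X) (s t : R) := [&& phi (x, s) <= u x, u x < phi (x, t) &
  (phi (x, t) - u x) * h x (a, phi (x, s)) + (u x - phi (x, s)) * h x (a, phi (x, t)) !=
  c x * (phi (x, t) - phi (x, s))].
pose bad3 (z : X * R * R) := bad z.1.1 z.1.2 z.2.
have mbad : measurable_fun setT bad3.
  have m11 : measurable_fun setT (fun z : X * R * R => z.1.1).
    exact: (measurableT_comp measurable_fst measurable_fst).
  have m12 : measurable_fun setT (fun z : X * R * R => z.1.2).
    exact: (measurableT_comp measurable_snd measurable_fst).
  have m1 : measurable_fun setT (fun z : X * R * R => phi (z.1.1, z.1.2)).
    by apply: (measurableT_comp mphi); exact: measurable_fun_pair.
  have m2 : measurable_fun setT (fun z : X * R * R => phi (z.1.1, z.2)).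
    by apply: (measurableT_comp mphi); apply: measurable_fun_pair => //; exact: measurable_snd.
  have mu3 : measurable_fun setT (fun z : X * R * R => u z.1.1) by exact: (measurableT_comp _ m11).
  have mc3 : measurable_fun setT (fun z : X * R * R => c z.1.1) by exact: (measurableT_comp _ m11).
  have mh3 (p : X * R * R -> R) : measurable_fun setT p ->
      measurable_fun setT (fun z : X * R * R => h z.1.1 (a, p z)).
    move=> mp; apply: (measurableT_comp mh); apply: measurable_fun_pair => //.
    exact: (measurableT_comp (measurable_pair1 a) mp).
  have mh1 := mh3 _ m1; have mh2 := mh3 _ m2.
  apply: measurable_and; first exact: measurable_fun_ler.
  apply: measurable_and; first exact: measurable_fun_ltr.
  apply: measurable_neg; apply: measurable_fun_eqr.
    by apply: measurable_funD; apply: measurable_funM => //; exact: measurable_funB.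
  by apply: measurable_funM => //; exact: measurable_funB.
pose N : set (X * R * R) := [set z | bad3 z].
have mN : measurable N.
  rewrite (_ : N = bad3 @^-1` [set true]); last by apply/seteqP; split.
  by rewrite -[X in measurable X]setTI; exact: mbad.
(* Exchanging the two levels gives the opposite order of quantification required by
   [affine_of_pairs]. *)
pose sw (z : X * R * R) : X * R * R := (z.1.1, z.2, z.1.2).
have msw : measurable_fun setT sw.
  apply: measurable_fun_pair; last exact: (measurableT_comp measurable_snd measurable_fst).
  by apply: measurable_fun_pair; [exact: (measurableT_comp measurable_fst measurable_fst)|exact: measurable_snd].
have mN' : measurable (sw @^-1` N) by rewrite -[X in measurable X]setTI; exact: msw.
have msec s : measurable_fun setT (fun x => phi (x, s)).
  exact: (measurableT_comp mphi (measurable_pair2 s)).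
have good s t : {ae marginal P, forall x, ~ N (x, s, t)}.
  have := x1_pair x1 lP (msec s) (msec t) (fun x => sphi x s) (fun x => sphi x t) rf mw.
  apply: filterS => x hx /and3P[/= le lt /eqP]; apply.
  by apply: hx; rewrite le.
have [_ restr _ _] := std.
have m2 := cond_mean M_wf restr rf lP lP mw (or_introl (aeW _ (fun x => erefl))).
have g1 := ae_swap2 mN good.
have g2 := ae_swap2 mN' (fun s t => good t s).
apply: filterS3 (filterI g1 g2) m2 (well_formed_arms lP) => x [G1 G2] [hi _] [kp Ki Km].
have pg b : 0 < arm_coord (pscore M P x) b by exact: pscore_gt0.
have imp s t : ~ N (x, s, t) -> phi (x, s) <= u x < phi (x, t) ->
    (phi (x, t) - u x) * h x (a, phi (x, s)) + (u x - phi (x, s)) * h x (a, phi (x, t)) =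
    c x * (phi (x, t) - phi (x, s)).
  move=> nN /andP[le lt]; apply/eqP/negP => ne; apply: nN.
  by rewrite /N /= /bad3 /bad /= le lt; apply/negP.
apply: (@affine_of_pairs R (arm_law (kern M P x) a) (fun s => phi (x, s)) (fun y => h x (a, y))
   (c x) (u x)).
- exact: (measurableT_comp mphi (measurable_pair1 x)).
- by move=> B mB; exact: lphi.
- apply: (measurableT_comp mh); apply: (measurableT_comp (measurable_pair1 x)).
  exact: measurable_pair1.
- exact: Ki.
- exact: Km.
- rewrite /c fineK// integrable_fin_num//; exact: (arm_integrable_of kp pg a hi).
- by apply: filterS G1 => s; apply: filterS => t; exact: imp.
- by apply: filterS G2 => t; apply: filterS => s; exact: imp.
Qed.

End affine.

(** * Mean-shifting directions *)

Lemma univ_measurable_of (R : realType) d (T : measurableType d) (A : set T) :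
  measurable A -> univ_measurable R A.
Proof. by move=> mA mu; exists A, A; split=> //; rewrite setDv measure0. Qed.

Lemma univ_measurableU (R : realType) d (T : measurableType d) (A A' : set T) :
  univ_measurable R A -> univ_measurable R A' -> univ_measurable R (A `|` A').
Proof.
move=> hA hA' mu.
have [B [C [mB mC BA AC BC]]] := hA mu; have [B' [C' [mB' mC' BA' AC' BC']]] := hA' mu.
exists (B `|` B'), (C `|` C'); split; [exact: measurableU|exact: measurableU| | |].
- by apply: setUSS.
- by apply: setUSS.
- have n1 : mu.-negligible (C `\` B) by apply/negligibleP => //; exact: measurableD.
  have n2 : mu.-negligible (C' `\` B') by apply/negligibleP => //; exact: measurableD.
  apply/negligibleP; first by apply: measurableD; exact: measurableU.
  apply: negligibleS (negligibleU n1 n2).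
  by move=> x [[Cx|Cx] /not_orP[nB nB']]; [left|right].
Qed.

Lemma argmaxE (R : realType) (v : R * R) : argmax v = (v.2 <= v.1, v.1 <= v.2).
Proof.
rewrite /argmax; congr (_, _); apply/forallP/idP => [|h []] /=; rewrite ?lexx//.
  exact: (@^~ true).
exact: (@^~ false).
Qed.

Lemma arm_coord_inj (T : Type) (v v' : T * T) :
  (forall a, arm_coord v a = arm_coord v' a) -> v = v'.
Proof. by case: v v' => [v1 v2] [w1 w2] h; have /= -> := h false; have /= -> := h true. Qed.

Lemma same_law_arm_mean (R : realType) (Q Q' : probability (obs R) R) a :
  same_law Q Q' -> arm_mean Q a = arm_mean Q' a.
Proof.
by move=> /(same_law_arm a) QQ; rewrite /arm_mean unlock (same_law_integral QQ).
Qed.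

Section slope.
Context (R : realType) (dX : measure_display) (X : measurableType dX).
Context (dV : measure_display) (V : measurableType dV).
Variable (M : model R X) (L : local_model R X).
Hypothesis M_wf : well_formed M.
Hypothesis std : standing_conditions M L.
Local Notation W := (obs R).
Local Notation law := (probability (X * W)%type R).
Implicit Types (P : law) (f : score R X V) (w : X -> V).

Lemma measurable_set_dir P (t : X -> R) : laws M P -> measurable_fun setT t ->
  measurable_fun setT (fun x => set_dir (kappa M P x) (t x)).
Proof.
move=> lP mt; have mu0 := measurable_umean M_wf false lP.
have mu1 := measurable_umean M_wf true lP.
rewrite (_ : (fun _ => _) = fun x =>
  (if (umean M P x).2 <= (umean M P x).1 then t x else 0,
   if (umean M P x).1 <= (umean M P x).2 then t x else 0)); last first.
  by apply/funext => x; rewrite /set_dir /kappa argmaxE.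
apply: measurable_fun_pair; apply: measurable_fun_ifT => //; exact: measurable_fun_ler.
Qed.

Section perturbation.
Variables (P : law) (D : X -> set (R * R)) (Qd : X -> R * R -> pprobability W R).
Hypothesis lP : laws M P.
Hypothesis x3 : X3 M L P D Qd.
Hypothesis mD : measurable [set z : X * (R * R) | D z.1 z.2].
Variables (delta : X -> R * R).
Hypothesis mdelta : measurable_fun setT delta.
Hypothesis deltaD : {ae marginal P, forall x, D x (delta x)}.
Hypothesis D0 : {ae marginal P, forall x, D x (0, 0)}.

Let measurable_graph (e : X -> R * R) : measurable_fun setT e ->
  measurable [set z : X * pprobability W R |
    D z.1 (e z.1) /\ same_law z.2 (Qd z.1 (e z.1))].
Proof.
move=> me; have [mG _ _ _] := x3.
pose q (z : X * pprobability W R) := (z.1, e z.1, z.2).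
have mq : measurable_fun setT q.
  apply: measurable_fun_pair; last exact: measurable_snd.
  by apply: measurable_fun_pair; [exact: measurable_fst|exact: (measurableT_comp me measurable_fst)].
by rewrite -[X in measurable X]setTI; exact: (mq measurableT _ mG).
Qed.

(** [X3] constrains the graph of [Qd] only over [D]; a constant law off [D] keeps preimages under
    control. *)
Let selected (e : X -> R * R) (x : X) : pprobability W R :=
  if pselect (D x (e x)) is left _ then Qd x (e x) else point.

Let selectedE e x : D x (e x) -> selected e x = Qd x (e x).
Proof. by rewrite /selected; case: pselect. Qed.

(** Over [D], the preimage of [C] is the projection of the measurable graph cut by [C]; off [D] it
    is all or nothing. The graph being known only up to [same_law] is harmless, as [C] is
    measurable. *)
Let selected_univ (e : X -> R * R) : measurable_fun setT e ->
  univ_measurable_fun R (selected e).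
Proof.
move=> me C mC.
pose H := [set z : X * pprobability W R | D z.1 (e z.1) /\ same_law z.2 (Qd z.1 (e z.1))]
  `&` [set z | C z.2].
have mH : measurable H.
  apply: measurableI; first exact: measurable_graph.
  by rewrite -[X in measurable X]setTI; exact: (measurable_snd measurableT _ mC).
have uH := pprob_projection mH.
have mDe : measurable [set x | D x (e x)].
  have m : measurable_fun setT (fun x => (x, e x)) by exact: measurable_fun_pair.
  by rewrite -[X in measurable X]setTI; exact: (m measurableT _ mD).
have -> : selected e @^-1` C = [set x | exists Q, H (x, Q)] `|`
    (~` [set x | D x (e x)] `&` [set x | C point]).
  apply/seteqP; split=> x /=.
    have [Dx|nDx] := pselect (D x (e x)).
      by rewrite /preimage /= selectedE// => CQ; left; exists (Qd x (e x)).
    by rewrite /preimage /= /selected; case: pselect => // _ Cp; right.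
  move=> [[Q [[/= Dx Qx] CQ]]|[/= nDx Cp]].
    by rewrite /preimage /= selectedE//; exact: (same_law_measurable mC Qx).
  by rewrite /preimage /= /selected; case: pselect.
apply: univ_measurableU => //; apply: univ_measurable_of.
apply: measurableI; first exact: measurableC.
have [Cp|nCp] := pselect (C point).
  by rewrite (_ : [set x | C point] = setT)//; apply/seteqP; split.
by rewrite (_ : [set x | C point] = set0)//; apply/seteqP; split.
Qed.

Let cost_below (m : R) : set (X * pprobability W R) :=
  [set z | adm_graph L z /\ cost L z.1 z.2 <= m].

Let cost_below_same m x Q Q' : same_law Q Q' -> cost_below m (x, Q) -> cost_below m (x, Q').
Proof.
move=> QQ h; have mS := measurable_xsection x (measurable_cost_below std m).
by have := same_law_measurable mS QQ; rewrite /xsection /= !inE; apply.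
Qed.

(** The shift is made only where its law costs at most [m] and is zero elsewhere. The glued law has
    the propensities of [P], so double robustness gives the mean along it of the score with the
    nuisances of [P]. *)
Lemma x3_bounded_mean f w (m : R) : 0 <= m ->
  robust_class M f -> measurable_fun setT w ->
  {ae marginal P, forall x, cost_below m (x, Qd x (delta x)) ->
    (Qd x (delta x) : probability W R).-integrable setT (fun v => (plug M f w P P (x, v))%:E) /\
    (\int[Qd x (delta x)]_v (plug M f w P P (x, v))%:E =
      (maxarm (umean M P x + delta x))%:E)%E}.
Proof.
move=> m0 rf mw.
have [_ restr [c1 cP _] _] := std.
have [admP _] := cP _ lP.
have [_ base props glueP] := x3.
pose H := [set z : X * pprobability W R | D z.1 (delta z.1) /\ same_law z.2 (Qd z.1 (delta z.1))]
  `&` cost_below m.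
have mH : measurable H.
  by apply: measurableI; [exact: measurable_graph|exact: (measurable_cost_below std m)].
(* The region of cheap shifts is a projection, hence only universally measurable; its measurable
   inner approximation [B] loses a null set and keeps the truncated shift measurable. *)
have [B [C [mB mC BA AC BC]]] := pprob_projection mH (marginal P).
have BP x : B x -> cost_below m (x, Qd x (delta x)).
  by move=> /BA[Q [[/= _ Qx] cx]]; exact: cost_below_same Qx cx.
pose e x := if x \in B then delta x else (0, 0).
have me : measurable_fun setT e.
  apply: measurable_fun_ifT => //.
  apply: (measurable_fun_bool true); rewrite setTI (_ : _ @^-1` _ = B)//.
  by apply/seteqP; split=> x /=; [exact: set_mem|exact: mem_set].
have eD : {ae marginal P, forall x, D x (e x)}.
  by apply: filterS2 deltaD D0 => x Dx D0x; rewrite /e; case: ifP.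
have sel : selection L P (fun x => [set Q | exists2 delta, D x delta & same_law Q (Qd x delta)])
    (selected e).
  split; first exact: selected_univ.
    by apply: filterS eD => x Dx; exists (e x) => //; rewrite selectedE.
  apply: (selection_cost M_wf std lP m0).
  apply: filterS3 eD admP base => x Dx Ax bx; rewrite selectedE// /e.
  have [k1 _ _] := c1 _ _ Ax.
  case: ifPn => [/set_mem/BP[_ /= h]|_].
    by rewrite (le_trans h)// lerDl (le_trans ler01).
  have [|_ /=] := @cost_below_same (cost L x (kern M P x)) x _ _ (same_law_sym bx).
    by split.
  by move=> /le_trans; apply; rewrite lerDr.
have [P' [lP' mPP' kP']] := glueP _ sel.
have toP S : {ae marginal P', forall x, S x} -> {ae marginal P, forall x, S x}.
  exact: same_law_marginal_ae.
have ofP S : {ae marginal P, forall x, S x} -> {ae marginal P', forall x, S x}.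
  by apply: same_law_marginal_ae; exact: same_law_sym.
have [_ [_ uP'] _ _] := M_wf lP'.
(* Gluing provides only the marginal and the kernel of [P']; its nuisances are recovered from the
   kernel by well-formedness. *)
have nuis : {ae marginal P, forall x, [/\ pscore M P x = pscore M P' x,
    umean M P' x = umean M P x + e x & kappa M P' x = kappa M P x]}.
  apply: filterS (filterI (filterI eD kP') (filterI props (filterI (toP _ (well_formed_arms M_wf lP')) (toP _ uP')))).
  move=> x [[Dx kx] [px [[kp' _ _] ux']]].
  have [_ _ pq uq kq] := px _ Dx.
  rewrite selectedE// in kx.
  have ue : umean M P' x = umean M P x + e x.
    apply: arm_coord_inj => a; have [_ ->] := ux' a.
    by rewrite (same_law_arm_mean a kx); have [_] := uq a.
  split=> //; last by rewrite /kappa ue kq.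
  apply: arm_coord_inj => a; apply: EFin_inj.
  by rewrite -pq -kp' kx//; exact: measurable_arm_set.
have nuis2 : {ae marginal P', forall x, pscore M P x = pscore M P' x}.
  by apply: ofP; apply: filterS nuis => x [].
(* Data from [P'] with nuisances from [P]: the outcome means may differ, and agreement of the
   propensities is the alternative that applies. *)
have cm := toP _ (cond_mean M_wf restr rf lP' lP mw (or_intror nuis2)).
have CB : {ae marginal P, forall x, ~ (C `\` B) x}.
  exists (C `\` B); split=> //; first exact: measurableD.
  by move=> x /= /contrapT.
apply: filterS (filterI (filterI cm nuis) (filterI (filterI kP' eD) (filterI CB deltaD))).
move=> x [[[hi hE] [_ ux kax]] [[kx eDx] [nCB Dx]]] cx.
have Bx : B x.
  apply: contrapT => nB; apply: nCB; split=> //; apply: AC.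
  by exists (Qd x (delta x)); split.
rewrite selectedE// in kx.
have ex : e x = delta x by rewrite /e mem_set.
have plugE v : plug M f w P P' (x, v) = plug M f w P P (x, v) by rewrite /plug /= kax.
rewrite -ex -ux; split.
  by apply: (same_law_integrable kx); under eq_fun do rewrite -plugE.
rewrite -(same_law_integral kx _ measurableT).
by under eq_integral do rewrite -plugE.
Qed.

Lemma x3_mean f w : robust_class M f -> measurable_fun setT w ->
  {ae marginal P, forall x,
    (Qd x (delta x) : probability W R).-integrable setT (fun v => (plug M f w P P (x, v))%:E) /\
    (\int[Qd x (delta x)]_v (plug M f w P P (x, v))%:E =
      (maxarm (umean M P x + delta x))%:E)%E}.
Proof.
move=> rf mw; have [_ _ props _] := x3.
have h := ae_foralln (fun n : nat => x3_bounded_mean (ler0n R n) rf mw).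
apply: filterS3 h deltaD props => x h Dx px; have [Ax _ _ _ _] := px _ Dx.
apply: (h (Num.truncn (cost L x (Qd x (delta x)))).+1); split=> //=.
by rewrite ltW// truncnS_gt.
Qed.

End perturbation.
End slope.

(** * The variance floor *)

Lemma variance_ae_eq (R : realType) d (T : measurableType d) (P : probability T R)
    (g h : T -> R) : measurable_fun setT g -> measurable_fun setT h ->
  {ae P, forall x, g x = h x} -> 'V_P[g] = 'V_P[h].
Proof.
move=> mg mh gh.
have e : ('E_P[g] = 'E_P[h])%E.
  rewrite unlock; apply: ae_eq_integral => //; [exact/measurable_EFinP..|].
  by apply: filterS gh => x ->.
rewrite /variance unlock e [in LHS]unlock [in RHS]unlock; apply: ae_eq_integral => //.
- by apply/measurable_EFinP; apply: measurable_funM; exact: measurable_funB.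
- by apply/measurable_EFinP; apply: measurable_funM; exact: measurable_funB.
- by apply: filterS gh => x gx _; rewrite !fctE /= gx.
Qed.

(** Preservation of the argmax excludes a downward shift that lets an inactive arm take over. *)
Lemma maxarm_set_dir (R : realType) (v : R * R) t :
  argmax (v + set_dir (argmax v) t) = argmax v ->
  maxarm (v + set_dir (argmax v) t) = maxarm v + t.
Proof.
case: v => v1 v2; rewrite !argmaxE /maxarm /set_dir /=.
have [h1|h1] := leP v2 v1; have [h2|h2] := leP v1 v2; rewrite /= ?addr0 => -[].
- have -> : v1 = v2 by apply/eqP; rewrite eq_le h1 h2.
  by rewrite !maxxx.
- by move=> h3 _; rewrite !max_l// ltW.
- by move=> _ h3; rewrite !max_r// ltW.
- by have := lt_trans h1 h2; rewrite ltxx.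
Qed.

Section bounds.
Context (R : realType) (dX : measure_display) (X : measurableType dX).
Context (dV : measure_display) (V : measurableType dV).
Variable (M : model R X) (L : local_model R X).
Hypothesis M_wf : well_formed M.
Local Notation W := (obs R).
Local Notation law := (probability (X * W)%type R).
Implicit Types (f : score R X V) (w : X -> V).
Variable P : law.
Hypothesis lP : laws M P.

Lemma kappa_ex x : exists a, arm_coord (kappa M P x) a.
Proof.
rewrite /kappa argmaxE; have [h|h] := leP (umean M P x).2 (umean M P x).1.
  by exists false.
by exists true; rewrite /= ltW.
Qed.

Lemma measurable_maxu : measurable_fun setT (maxu M P).
Proof. by have [_ _ _ ui] := M_wf lP; apply/measurable_EFinP; exact: measurable_int ui. Qed.

Lemma measurable_kappa a : measurable_fun setT (fun x => arm_coord (kappa M P x) a).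
Proof.
have mu0 := measurable_umean M_wf false lP.
have mu1 := measurable_umean M_wf true lP.
rewrite /kappa; under eq_fun do rewrite argmaxE.
by case: a => /=; exact: measurable_fun_ler.
Qed.

Lemma measurable_precision (s2 : X -> bool -> R) :
  (forall a, measurable_fun setT (s2 ^~ a)) ->
  measurable_fun setT (fun x => precision M P (s2 x) x).
Proof.
move=> ms; rewrite /precision; under eq_fun do rewrite sum_bool.
have m a : measurable_fun setT (fun x => if arm_coord (kappa M P x) a then
    arm_coord (pscore M P x) a / s2 x a else 0).
  apply: measurable_fun_ifT => //; first exact: measurable_kappa.
  apply: measurable_funM; first exact: measurable_pscore.
  exact: (measurableT_comp (@measurable_invr R) (ms a)).
exact: measurable_funD (m true) (m false).
Qed.

Lemma measurable_sigma2 a : measurable_fun setT (fun x => fine (sigma2 M P x a)).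
Proof.
apply: measurableT_comp => //; exact: (measurable_arm_var a (kern_measurable M_wf lP)).
Qed.

Local Notation prec x := (precision M P (fun a => fine (sigma2 M P x a)) x).

Lemma measurable_prec : measurable_fun setT (fun x => prec x).
Proof. by apply: measurable_precision => a; exact: measurable_sigma2. Qed.

Lemma measurable_oracle : measurable_fun setT (oracle M P).
Proof.
pose G a (z : X * W) := maxu M P z.1 + (if arm_coord (kappa M P z.1) a then
    lambda_star M P z.1 a / arm_coord (pscore M P z.1) a *
    (z.2.2 - arm_coord (umean M P z.1) a) else 0).
rewrite (_ : oracle M P = fun z => if z.2.1 then G true z else G false z); last first.
  by apply/funext => -[x [[] y]].
have m1 := @measurable_fst _ _ X W.
have mb : measurable_fun setT (fun z : X * W => z.2.1).
  exact: (measurableT_comp measurable_fst measurable_snd).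
have my : measurable_fun setT (fun z : X * W => z.2.2).
  exact: (measurableT_comp measurable_snd measurable_snd).
have mG a : measurable_fun setT (G a).
  have mk : measurable_fun setT (fun z : X * W => arm_coord (kappa M P z.1) a).
    exact: (measurableT_comp (measurable_kappa a) m1).
  have mp : measurable_fun setT (fun z : X * W => arm_coord (pscore M P z.1) a).
    exact: (measurableT_comp (measurable_pscore M_wf a lP) m1).
  have mu_ : measurable_fun setT (fun z : X * W => arm_coord (umean M P z.1) a).
    exact: (measurableT_comp (measurable_umean M_wf a lP) m1).
  have ms : measurable_fun setT (fun z : X * W => fine (sigma2 M P z.1 a)).
    exact: (measurableT_comp (measurable_sigma2 a) m1).
  have mT : measurable_fun setT (fun z : X * W => prec z.1).
    exact: (measurableT_comp measurable_prec m1).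
  have inv (g : X * W -> R) : measurable_fun setT g -> measurable_fun setT (fun z => (g z)^-1).
    by move=> mg; exact: (measurableT_comp (@measurable_invr R) mg).
  apply: measurable_funD; first exact: (measurableT_comp measurable_maxu m1).
  apply: measurable_fun_ifT => //; apply: measurable_funM; last exact: measurable_funB.
  apply: measurable_funM; last exact: inv.
  apply: measurable_fun_ifT => //; apply: measurable_funM; last exact: inv.
  by apply: measurable_funM => //; exact: inv.
exact: measurable_fun_ifT.
Qed.

Hypothesis variances : variance_conditions M P.

Lemma sigma2_fin : {ae marginal P, forall x,
  (forall a, arm_var (kern M P x) a = (fine (sigma2 M P x a))%:E) /\
  (forall a, arm_coord (kappa M P x) a -> 0 < fine (sigma2 M P x a))}.
Proof.
apply: filterS variances => x [v1 v2].
have fin a : sigma2 M P x a \is a fin_num by rewrite ge0_fin_numE ?v1// variance_ge0.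
split=> a; first by rewrite fineK.
by move=> /v2; rewrite -lte_fin fineK.
Qed.

Lemma oracle_variance : {ae marginal P, forall x,
  measurable_fun setT (fun v => oracle M P (x, v)) /\
  cond_var M P (oracle M P) x = ((prec x)^-1)%:E}.
Proof.
apply: filterS2 (well_formed_arms M_wf lP) sigma2_fin => x [kp Ki Km] [Kv v0].
have pg b : 0 < arm_coord (pscore M P x) b by exact: (pscore_gt0 M_wf x b lP).
have := variance_optimal kp pg Ki Km Kv (maxu M P x) (kappa_ex x) v0.
move=> [mh _ Vh].
rewrite /cond_var (_ : (fun v => oracle M P (x, v)) = fun v : W => maxu M P x +
  (if arm_coord (kappa M P x) v.1 then
     arm_coord (pscore M P x) v.1 / fine (sigma2 M P x v.1) / prec x /
       arm_coord (pscore M P x) v.1 * (v.2 - arm_coord (umean M P x) v.1) else 0)) //.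
apply/funext => -[a y]; rewrite /oracle /lambda_star -[(a, y).1]/a -[(a, y).2]/y.
by case: (arm_coord (kappa M P x) a).
Qed.

Lemma variance_floor f w : standing_conditions M L -> max_arm_conditions M L ->
  robust_class M f -> measurable_fun setT w ->
  {ae marginal P, forall x, (((prec x)^-1)%:E <= cond_var M P (plug M f w P P) x)%E}.
Proof.
move=> std /(_ _ lP)[x1 [D [RP [epsP [Qd [[mD _ meps x2] x3]]]]]] rf mw.
(* Positive, measurable and strictly inside the range of the path in [D]. *)
pose t x := epsP x / 2.
pose delta x := set_dir (kappa M P x) (t x).
have mt : measurable_fun setT t by exact: measurable_funM.
have mdelta : measurable_fun setT delta by exact: measurable_set_dir.
have t_gt0 : {ae marginal P, forall x, 0 < t x}.
  by apply: filterS x2 => x [_ _ _ e0 _]; rewrite /t divr_gt0.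
have Dd : {ae marginal P, forall x, D x (delta x)}.
  apply: filterS2 t_gt0 x2 => x tx [_ _ _ _ dx]; apply: dx.
  by move: tx; rewrite /t => tx; rewrite gtr0_norm//; lra.
have D0 : {ae marginal P, forall x, D x (0, 0)} by apply: filterS x2 => x [].
have mean' := x3_mean M_wf std lP x3 mD mdelta Dd D0 rf mw.
have [_ restr _ _] := std.
have mean := cond_mean M_wf restr rf lP lP mw (or_introl (aeW _ (fun x => erefl))).
have aff0 := x1_affine M_wf std false x1 lP rf mw.
have aff1 := x1_affine M_wf std true x1 lP rf mw.
have [_ _ props _] := x3.
have mh := measurable_plug rf lP mw.
apply: filterS (filterI (filterI (filterI aff0 aff1) (filterI mean mean'))
  (filterI (filterI Dd props) (filterI t_gt0 (filterI (well_formed_arms M_wf lP) sigma2_fin)))).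
move=> x [[[[b0 hb0] [b1 hb1]] [[hi hE] [hi' hE']]] [[Dx px] [tx [[kp Ki Km] [Kv v0]]]]].
have pg b : 0 < arm_coord (pscore M P x) b by exact: (pscore_gt0 M_wf x b lP).
have [Ax dom Q'p Q'u kq] := px _ Dx.
pose b a := if a then b1 else b0.
pose c a := fine (\int[arm_law (kern M P x) a]_y (plug M f w P P (x, (a, y)))%:E).
have aff a : {ae arm_law (kern M P x) a, forall y,
    plug M f w P P (x, (a, y)) = c a + b a * (y - arm_coord (umean M P x) a)}.
  by case: a.
have mhx : measurable_fun setT (fun v => plug M f w P P (x, v)).
  exact: (measurableT_comp mh (measurable_pair1 x)).
have Q'i a : arm_integrable (Qd x (delta x)) a by have [] := Q'u a.
have Q'm a : ('E_(arm_law (Qd x (delta x)) a)[fun y => y] =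
    (arm_coord (umean M P x + delta x) a)%:E)%E.
  have [i <-] := Q'u a; rewrite /arm_mean fineK// unlock.
  exact: integrable_fin_num.
have sl := slope_identity kp pg Ki Km mhx aff dom Q'p Q'i Q'm hi hi' hE hE'.
have sumb : \sum_(a : bool | arm_coord (kappa M P x) a) arm_coord (pscore M P x) a * b a = 1.
  have mE : maxarm (umean M P x + delta x) - maxu M P x = t x.
    by rewrite (@maxarm_set_dir _ (umean M P x) (t x) kq) /maxu addrAC subrr add0r.
  move: sl; rewrite mE.
  have dE a : arm_coord (umean M P x + delta x) a - arm_coord (umean M P x) a =
      if arm_coord (kappa M P x) a then t x else 0.
    by rewrite /delta /set_dir; case: a => /=; rewrite addrAC subrr add0r.
  rewrite !dE => sl; apply: (mulIf (lt0r_neq0 tx)); rewrite mul1r -[RHS]sl sum_bool.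
  by case: (arm_coord _ true); case: (arm_coord _ false); ring.
have Emu : ('E_(kern M P x : probability W R)[fun v => plug M f w P P (x, v)] = (maxu M P x)%:E)%E.
  by rewrite unlock.
exact: (variance_lower kp pg Ki Km Kv mhx aff Emu (kappa_ex x) v0 sumb).
Qed.

Lemma Vmin_essinf w : standing_conditions M L -> max_arm_conditions M L ->
  oracle_realization V M P -> measurable_fun setT w ->
  measurable_fun setT (Vmin M P w) /\
  {ae marginal P, forall x, Vmin M P w x = ((prec x)^-1)%:E}.
Proof.
move=> std mx [[f0 [w0 [rf0 mw0 f0E]]] Voracle] mw.
set F := [set g | exists f, [/\ robust_class M f, ('V_P[plug M f w P P] < +oo)%E &
                           g = cond_var M P (plug M f w P P)]].
(* The oracle is realized with its own auxiliary map [w0], whereas [Vmin] is taken at [w]. Building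
   [w0] into the score gives a member of the family whose value does not depend on [w]. *)
pose f1 : score R X V := fun z => f0 (z.1, w0 z.1.1.1.1).
have rf1 : robust_class M f1.
  split; last first.
    by move=> Q Q' w' lQ lQ' mw' n; have [_ h] := rf0; exact: (h Q Q' w0 lQ lQ' mw0 n).
  move=> mS B mB; have [mf0 _] := rf0.
  pose g (z : X * W * ((R * R) * (R * R)) * (bool * bool) * V) := (z.1, w0 z.1.1.1.1).
  have mg : measurable_fun setT g.
    apply: measurable_fun_pair; first exact: measurable_fst.
    apply: (measurableT_comp mw0).
    exact: (measurableT_comp measurable_fst (measurableT_comp measurable_fst
      (measurableT_comp measurable_fst measurable_fst))).
  rewrite (_ : _ `&` _ = setT `&` g @^-1` (@score_dom R dX X dV V `&` f0 @^-1` B)).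
    by apply: mg => //; exact: mf0.
  by apply/seteqP; split=> z /=; [move=> [h1 h2]; split|move=> [_ [h1 h2]]; split].
have plugE : plug M f1 w P P = plug M f0 w0 P P by [].
have mplug := measurable_plug rf0 lP mw0.
have Ff1 : F (cond_var M P (plug M f1 w P P)).
  exists f1; split=> //; rewrite plugE.
  by rewrite (variance_ae_eq mplug measurable_oracle f0E).
have Vf1 : {ae marginal P, forall x, cond_var M P (plug M f1 w P P) x = ((prec x)^-1)%:E}.
  have := disint_ae (kern_measurable M_wf lP) (kern_rect M_wf lP) f0E.
  apply: filterS2 oracle_variance => x [mo <-] e.
  rewrite /cond_var plugE; apply: variance_ae_eq => //.
  exact: (measurableT_comp mplug (measurable_pair1 x)).
have mV0 : measurable_fun setT (fun x => ((prec x)^-1)%:E).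
  by apply/measurable_EFinP; exact: (measurableT_comp (@measurable_invr R) measurable_prec).
(* A lower bound attained almost everywhere by a member is an essential infimum. [Vmin] is some
   other representative, so its defining properties are then compared with these to get equality
   almost everywhere. *)
have ess0 : is_essinf (marginal P) F (fun x => ((prec x)^-1)%:E).
  split=> //.
    by move=> _ [f [rf _ ->]]; exact: variance_floor.
  move=> V' mV' hV'; apply: filterS2 (hV' _ Ff1) Vf1 => x le e.
  by rewrite -e.
have [mV le1 le2] : is_essinf (marginal P) F (Vmin M P w) by exact: (xgetI _ ess0).
have [_ le3 le4] := ess0.
split=> //; apply: filterS2 (le4 _ mV le1) (le2 _ mV0 le3) => x h1 h2.
by apply/eqP; rewrite eq_le h1 h2.
Qed.

End bounds.

Theorem corollary5p8 (R : realType) (X Waux : ptopologicalType)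
    (polish_X : polish R X) (polish_Waux : polish R Waux)
    (M : model R (Borel X)) (M_wf : well_formed M)
    (L : local_model R (Borel X)) (P : probability (Borel X * obs R)%type R)
    (MP : laws M P)
    (standing : standing_conditions M L)
    (max_arm : max_arm_conditions M L)
    (variances : variance_conditions M P)
    (oracle_real : oracle_realization (Borel Waux) M P)
    (w : Borel X -> Borel Waux) (w_meas : measurable_fun setT w) :
  let u x a := arm_coord (umean M P x) a in
  let pr x a := arm_coord (pscore M P x) a in
  let s2 x a := fine (sigma2 M P x a) in
  [/\ {ae marginal P, forall x,
         Vmin M P w x =
         ((\sum_(a : bool | arm_coord (kappa M P x) a) pr x a / s2 x a)^-1)%:E},
      {ae marginal P, forall x, u x false != u x true ->
         forall a, arm_coord (kappa M P x) a ->
         Vmin M P w x = (s2 x a / pr x a)%:E},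
      {ae marginal P, forall x, u x false = u x true ->
         Vmin M P w x =
         ((pr x true / s2 x true + pr x false / s2 x false)^-1)%:E},
      Vlow M P w = xu_guo_bound M P s2 &
      forall s : Borel X -> R, measurable_fun setT s ->
        {ae marginal P, forall x a, sigma2 M P x a = (s x)%:E} ->
        Vlow M P w = xu_guo_bound M P (fun x _ => s x) /\
        {ae marginal P, forall x, u x false = u x true ->
           Vmin M P w x = (s x)%:E}].
Proof.
move=> u pr s2.
have [mV VE] := Vmin_essinf M_wf MP variances standing max_arm oracle_real w_meas.
have ps x : pr x false + pr x true = 1 := pscore_sum M_wf x MP.
have kE x : kappa M P x = (u x true <= u x false, u x false <= u x true) by exact: argmaxE.
have kink x : u x false = u x true -> kappa M P x = (true, true) by rewrite kE => ->; rewrite lexx.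
(* Serves both the general and the homoscedastic bound. Almost everywhere equal measurable functions
   have equal integrals even when these are infinite. *)
have VlowE (s : Borel X -> bool -> R) :
    (forall a, measurable_fun setT (s ^~ a)) ->
    {ae marginal P, forall x, Vmin M P w x = ((precision M P (s x) x)^-1)%:E} ->
    Vlow M P w = xu_guo_bound M P s.
  move=> ms sE; rewrite /Vlow /xu_guo_bound; congr (_ + _)%E; rewrite unlock.
  apply: ae_eq_integral => //; last by apply: filterS sE.
  apply/measurable_EFinP; apply: (measurableT_comp (@measurable_invr R)).
  exact: measurable_precision.
split.
- exact: VE.
- apply: filterS VE => x -> ne a ka; congr EFin; rewrite /precision sum_bool.
  (* When the means differ, one active arm excludes the other, so the precision has a single
     summand. *)
  have : ~~ arm_coord (kappa M P x) (~~ a).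
    move: ka; rewrite kE; case: a => /= h; rewrite -ltNge lt_neqAle h ?ne ?andbT//.
    by rewrite eq_sym.
  by case: a ka => /= -> /negbTE ->; rewrite ?addr0 ?add0r invf_div.
- by apply: filterS VE => x -> /kink kx; rewrite /precision sum_bool kx.
- by apply: VlowE => // a; exact: measurable_sigma2.
- move=> s ms sE.
  have VsE : {ae marginal P, forall x, Vmin M P w x = ((precision M P (fun=> s x) x)^-1)%:E}.
    apply: filterS2 VE sE => x -> sx; congr (_^-1%:E).
    by apply: eq_bigr => a _; rewrite /= sx.
  split; first exact: VlowE.
  apply: filterS VsE => x -> /kink kx; rewrite /precision sum_bool kx /=; congr EFin.
  by rewrite -mulrDl addrC -[_.1]/(pr x false) -[_.2]/(pr x true) ps mul1r invrK.
Qed.
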